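(* For every Borel graph $G$ of polynomial growth and every $r\in\mathbb{N}$, there exists an $r$-toast $\mathcal{T}\subseteq[V(G)]^{<\infty}$ for $G$.
   Context: Graphs are undirected and simple. A Borel graph is a graph $G$ whose vertex set is a standard Borel space and whose adjacency relation is a Borel subset of $V(G)^2$. Let $B_G(u,r)$ be the closed ball of radius $r$ around $u$ in the graph metric (distance $\infty$ between different components), and for a set $K\subseteq V(G)$ let $B_G(K,r)=\bigcup_{u\in K}B_G(u,r)$. Put $\gamma_G(r)=\sup_{u\in V(G)}|B_G(u,r)|$ and $\mathrm{ar}(G)=\limsup_{r\to\infty}\frac{\log\gamma_G(r)}{\log(r+1)}$; $G$ is of polynomial growth if $\mathrm{ar}(G)<\infty$. For a standard Borel space $X$, $[X]^{<\infty}$ is the set of all finite subsets of $X$, with the standard Borel structure in which a subset is Borel iff its preimage in $\bigsqcup_{k=0}^\infty X^k$ under $(x_0,\dots,x_{k-1})\mapsto\{x_0,\dots,x_{k-1}\}$ is Borel. For $r\in\mathbb{N}$, an $r$-toast for $G$ is a Borel family $\mathcal{T}\subseteq[V(G)]^{<\infty}$ of finite sets such that: (T1) for every edge $uv\in E(G)$ there is $K\in\mathcal{T}$ with $u,v\in K$; and (T2) for all distinct $K,L\in\mathcal{T}$, either $B_G(K,r)\cap L=\emptyset$, or $B_G(K,r)\subseteq L$, or $B_G(L,r)\subseteq K$. *)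

(* Defs.v *)
From HB Require Import structures.
From mathcomp Require Import all_boot all_order all_algebra finmap.
From mathcomp Require Import all_classical all_reals all_analysis.

Set Implicit Arguments.
Unset Strict Implicit.
Unset Printing Implicit Defensive.

Import Order.TTheory GRing.Theory Num.Theory.

Local Open Scope classical_set_scope.
Local Open Scope ring_scope.

(* The library's measurableType and its complete spaces are pointed.  A Borel
   structure is therefore kept as a set system B on a bare type, so that the
   empty standard Borel space, and with it the empty graph, is included. *)

Definition complete_space (M : uniformType) : Prop :=
  forall F : set_system M, ProperFilter F -> cauchy F -> exists l : M, F --> l.

Definition separable_space (M : topologicalType) : Prop :=
  exists2 D : set M, countable D & dense D.

(* B is the transport, along a bijection, of the Borel sigma-algebra of a Polish
   space, given by a complete separable metric. *)
Definition standard_borel (R : realType) (V : Type) (B : set_system V) : Prop :=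
  exists (M : metricType R) (f : V -> M),
    [/\ complete_space M, separable_space M, bijective f
      & B = preimage_set_system setT f <<s @open M >>].

Definition prod_borel (V W : Type) (B : set_system V) (C : set_system W) :
    set_system (V * W) :=
  <<s [set X `*` Y | X in B & Y in C] >>.

Definition tuple_borel (V : Type) (B : set_system V) (k : nat) :
    set_system (k.-tuple V) :=
  <<s [set Z | exists (i : 'I_k) (X : set V),
         B X /\ Z = [set x | X (tnth x i)]] >>.

(* Borel subsets of the disjoint union of the V^k are those whose trace on each
   V^k is Borel. *)
Definition borel_finsets (V : choiceType) (B : set_system V)
    (T : set {fset V}) : Prop :=
  forall k : nat,
    tuple_borel B [set x : k.-tuple V | T [fset y in (x : seq V)]%fset].

Definition simple_graph (V : Type) (E : rel V) : Prop :=
  symmetric E /\ irreflexive E.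

Definition borel_graph (R : realType) (V : Type) (B : set_system V)
    (E : rel V) : Prop :=
  [/\ standard_borel R B, simple_graph E
    & prod_borel B B [set uv : V * V | E uv.1 uv.2]].

Section metric_growth.
Variables (R : realType) (V : choiceType) (E : rel V).
Local Open Scope ereal_scope.

(* +oo (the infimum of the empty set) between different components. *)
Definition gdist (u v : V) : \bar R :=
  ereal_inf [set ((size p)%:R)%:E |
    p in [set p : seq V | path E u p /\ last u p = v]].

Definition gball (u : V) (r : nat) : set V :=
  [set v | gdist u v <= (r%:R)%:E].

Definition gball_set (K : set V) (r : nat) : set V :=
  \bigcup_(u in K) gball u r.

Definition growth (r : nat) : \bar R :=
  ereal_sup [set counting (gball u r) | u in [set: V]].

(* The term r = 0, where the denominator is 0, does not affect the limsup. *)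
Definition growth_rate : \bar R :=
  limn_esup (fun r : nat => lne (growth r) / (ln (r.+1%:R : R))%:E).

Definition polynomial_growth : Prop := growth_rate < +oo.

End metric_growth.

Arguments gdist R {V} E u v.
Arguments gball R {V} E u r.
Arguments gball_set R {V} E K r.
Arguments growth R {V} E r.
Arguments growth_rate R {V} E.
Arguments polynomial_growth R {V} E.

Definition toast (R : realType) (V : choiceType) (B : set_system V)
    (E : rel V) (r : nat) (T : set {fset V}) : Prop :=
  [/\ borel_finsets B T,
      (forall u v : V, E u v -> exists2 K : {fset V}, T K & u \in K /\ v \in K)
    & (forall K L : {fset V}, T K -> T L -> K <> L ->
        [\/ gball_set R E [set` K] r `&` [set` L] = set0,
            gball_set R E [set` K] r `<=` [set` L]
          | gball_set R E [set` L] r `<=` [set` K]])].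

(* Main.v *)
Require Import Defs.
From mathcomp Require Import all_boot all_order all_algebra finmap.
From mathcomp Require Import all_classical all_reals all_analysis.
From mathcomp Require Import zify lra.

Set Implicit Arguments.
Unset Strict Implicit.
Unset Printing Implicit Defensive.

Import Order.TTheory GRing.Theory Num.Theory.
Local Open Scope classical_set_scope.

(* Polynomial growth makes every vertex x doubling, |B(x, 8s)| <= K |B(x, s)|,
   at infinitely many scales s = 8 ^ k. In a maximal 2s-separated set of
   vertices doubling at scale s, at most K points lie within 3s of any vertex,
   so as the radius t runs from 2s to 3s in K equal steps the trace of the net
   on B(x, t) must, for some i < K, have exactly i + 1 points and stay the same
   during one step. For fixed i, having the same trace is an equivalence
   relation on such vertices, whose classes have diameter at most 6s and are
   more than s / K apart. Hence each x lies, for some residue class of k modulo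
   a constant J and some i < K, in such a class at infinitely many scales.
   Sorting the components by the least pair (residue, i) that serves one of
   their vertices, one may use a single pair in each component.

   With the scales 8 ^ J apart, let U_n be the n-neighbourhood of the classes of
   level n and let H_n be U_n together with the r-neighbourhoods of the earlier
   pieces. The pieces of level n are the r-components of H_n meeting U_n: they
   are finite because the classes are sparse, and they form a laminar family
   because the r-neighbourhood of an earlier piece is r-connected inside H_n.
   Each edge is covered, since U_n catches it at the infinitely many levels at
   which a fixed vertex of its component lies in a class.

   All the sets involved are Borel because a quantifier ranging over a bounded
   ball preserves Borel sets, a special case of the Lusin-Novikov theorem that
   reduces to Lusin's separation of disjoint analytic sets. *)

(** * Borel sets and Lusin's separation theorem *)

(* The sigma-algebra generated by G, as an inductive predicate: unlike <<s G >>,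
   it does not unfold into a product when lemmas are applied to it. *)
Inductive sgen (T : Type) (G : set_system T) : (T -> Prop) -> Prop :=
| sg_gen A : G A -> sgen G A
| sg_False : sgen G (fun=> False)
| sgN P : sgen G P -> sgen G (fun x => ~ P x)
| sg_exN (P : nat -> T -> Prop) :
    (forall n, sgen G (P n)) -> sgen G (fun x => exists n, P n x).

Section SigmaAlgebraOfPredicates.
Variables (T : Type) (G : set_system T).
Local Notation S := (sgen G).

Lemma sg_allN (P : nat -> T -> Prop) :
  (forall n, S (P n)) -> S (fun x => forall n, P n x).
Proof.
move=> SP; suff -> : (fun x => forall n, P n x) = (fun x => ~ exists n, ~ P n x).
  by apply/sgN/sg_exN => n; apply: sgN.
apply/funext => x; apply/propext; split=> [Px [n]|]; first exact.
by move=> /forallNP nP n; have /contrapT := nP n.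
Qed.

Lemma sg_cst (Q : Prop) : S (fun=> Q).
Proof.
have [q|nq] := pselect Q; last first.
  by rewrite (_ : (fun=> Q) = (fun=> False)); [exact: sg_False|apply/funext => x; apply/propext].
rewrite (_ : (fun=> Q) = (fun=> ~ False)); first exact/sgN/sg_False.
by apply/funext => x; apply/propext; split=> // _ [].
Qed.

Lemma sg_and (P Q : T -> Prop) : S P -> S Q -> S (fun x => P x /\ Q x).
Proof.
move=> SP SQ.
suff -> : (fun x => P x /\ Q x) = (fun x => forall n : nat, if n is 0%N then P x else Q x).
  by apply: sg_allN => -[].
apply/funext => x; apply/propext; split=> [[p q] []//|h].
by split; [exact: (h 0%N)|exact: (h 1%N)].
Qed.

Lemma sg_or (P Q : T -> Prop) : S P -> S Q -> S (fun x => P x \/ Q x).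
Proof.
move=> SP SQ.
suff -> : (fun x => P x \/ Q x) = (fun x => exists n : nat, if n is 0%N then P x else Q x).
  by apply: sg_exN => -[].
apply/funext => x; apply/propext; split=> [[p|q]|[[|n]]].
- by exists 0%N.
- by exists 1%N.
- by left.
- by right.
Qed.

Lemma sg_exC (I : countType) (P : I -> T -> Prop) :
  (forall i, S (P i)) -> S (fun x => exists i, P i x).
Proof.
move=> SP; rewrite (_ : (fun x => _) =
    (fun x => exists n, exists i, choice.pickle i = n /\ P i x)); last first.
  apply/funext => x; apply/propext; split=> [[i Pi]|[n [i [_ Pi]]]]; last by exists i.
  by exists (choice.pickle i), i.
apply: sg_exN => n; have [[i <-]|ni] := pselect (exists i : I, choice.pickle i = n).
  rewrite (_ : (fun x => _) = P i)//; apply/funext => x; apply/propext.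
  by split=> [[j [/(pcan_inj choice.pickleK) ->]]//|Pi]; exists i.
rewrite (_ : (fun x => _) = (fun=> False)); first exact: sg_False.
by apply/funext => x; apply/propext; split=> // -[i [e _]]; apply: ni; exists i.
Qed.

Lemma sg_imp (P Q : T -> Prop) : S P -> S Q -> S (fun x => P x -> Q x).
Proof.
move=> SP SQ; suff -> : (fun x => P x -> Q x) = (fun x => ~ P x \/ Q x).
  by apply: sg_or => //; exact: sgN.
apply/funext => x; apply/propext; split=> [PQ|[nP /nP|]//].
by have [/PQ|] := pselect (P x); [right|left].
Qed.

End SigmaAlgebraOfPredicates.

Lemma sgenE (T : Type) (G : set_system T) : sgen G = <<s G >>.
Proof.
apply/seteqP; split=> A.
  elim=> {A} [A GA||A _ GA|F _ GF].
  - exact: sub_gen_smallest.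
  - rewrite (_ : (fun=> False) = set0); first exact: sigma_algebra0.
    by apply/seteqP; split.
  - rewrite (_ : (fun x => _) = setT `\` A); last by rewrite setTD.
    exact: sigma_algebraCD.
  - rewrite (_ : (fun x => _) = \bigcup_n F n); first exact: sigma_algebra_bigcup.
    by apply/seteqP; split=> [x [n Pn]|x [n _ Pn]]; exists n.
apply: smallest_sub A; last by move=> A; exact: sg_gen.
split=> [|A SA|F SF].
- rewrite (_ : set0 = (fun=> False)); first exact: sg_False.
  by apply/seteqP; split.
- by rewrite setTD; exact: sgN.
- rewrite (_ : \bigcup_k F k = (fun x => exists k, F k x)); first exact: sg_exN.
  by apply/seteqP; split=> [x [n _ Pn]|x [n Pn]]; exists n.
Qed.

Lemma sg_preimage (T U : Type) (G : set_system T) (H : set_system U) (g : T -> U) :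
  (forall A, H A -> sgen G (fun x => A (g x))) ->
  forall A, sgen H A -> sgen G (fun x => A (g x)).
Proof.
move=> HG A; elim=> {A} [A /HG//||A _ IH|F _ IH].
- exact: sg_False.
- exact: (sgN IH).
- exact: (sg_exN IH).
Qed.

(* What is used of a complete separable metric d: [pball n x y] stands for
   d x y < 2 ^- n. *)
Record polish (V : Type) := Polish {
  pball : nat -> V -> V -> Prop;
  dense_seq : nat -> V;
  pball_refl : forall n x, pball n x x;
  pball_sym : forall n x y, pball n x y -> pball n y x;
  pball_trans : forall n x y z, pball n.+1 x y -> pball n.+1 y z -> pball n x z;
  pball_eq : forall x y, (forall n, pball n x y) -> x = y;
  pball_open : forall n x y, pball n x y ->
    exists m, forall z, pball m x z -> pball n z y;
  pball_dense : forall n x, exists i, pball n x (dense_seq i);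
  pball_complete : forall u : nat -> V,
    (forall n, pball n (u n) (u n.+1)) -> exists l, forall n, pball n (u n.+2) l
}.

Section Polish.
Variables (V : choiceType) (P : polish V).
Local Notation pball := (pball P).

Lemma pball_mono m n x y : (m <= n)%N -> pball n x y -> pball m x y.
Proof.
move=> /subnK <-; elim: (n - m)%N => // k IH cxy; apply: IH.
by apply: (pball_trans cxy); exact: pball_refl.
Qed.

Definition p_open (U : set V) := forall x, U x -> exists n, forall y, pball n x y -> U y.

(** A point of this space is a valuation of the variables of a formula, so that Borel relations of
    every arity live on one space; [econs] binds variable 0 and shifts the others. *)
Definition env := nat -> V.
Definition econs (x : V) (w : env) : env := fun i => if i is j.+1 then w j else x.

Definition env_open : set_system env :=
  [set A | exists i U, p_open U /\ A = (fun w => U (w i))].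
Local Notation bor := (sgen env_open).

Lemma bor_open i U : p_open U -> bor (fun w => U (w i)).
Proof. by move=> oU; apply: sg_gen; exists i, U. Qed.

Lemma open_pball n x : p_open (pball n x).
Proof.
move=> y xy; have [m mP] := pball_open (pball_sym xy).
exists m => z yz; exact/pball_sym/mP.
Qed.

Lemma bor_pball n x i : bor (fun w => pball n x (w i)).
Proof. by apply: bor_open; exact: open_pball. Qed.

Lemma bor_subst (g : env -> env) :
  (forall i U, p_open U -> bor (fun w => U (g w i))) ->
  forall A, bor A -> bor (fun w => A (g w)).
Proof. by move=> gP; apply: sg_preimage => A [i [U [oU ->]]]; exact: gP. Qed.

Lemma bor_reindex (s : nat -> nat) A : bor A -> bor (fun w => A (fun i => w (s i))).
Proof.
by apply: (@bor_subst (fun w i => w (s i))) => i U oU; exact: bor_open.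
Qed.

(** * Analytic sets and their separation *)

Definition agree n (s t : nat -> nat) := forall i, (i < n)%N -> s i = t i.

Lemma agree_trans n s t u : agree n s t -> agree n t u -> agree n s u.
Proof. by move=> st tu i lin; rewrite st// tu. Qed.

Lemma agree_le m n s t : (m <= n)%N -> agree n s t -> agree m s t.
Proof. by move=> mn st i im; rewrite st// (leq_trans im). Qed.

Definition bclosed (D : set (nat -> nat)) :=
  forall s, (forall n, exists t, D t /\ agree n s t) -> D s.

Definition bcont (g : (nat -> nat) -> env) :=
  forall s i n, exists m, forall t, agree m s t -> pball n (g s i) (g t i).

(** The domain is a closed set and not the whole Baire space: this admits the empty set, and
    equalizers of continuous maps can serve as domains. *)
Definition analytic (A : set env) :=
  exists D g, [/\ bclosed D, bcont g & A = g @` D].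

Definition bsect (k : nat) (s : nat -> nat) : nat -> nat :=
  fun j => s (@choice.pickle (nat * nat)%type (k, j)).

Definition bjoin (s : nat -> nat -> nat) : nat -> nat :=
  fun n => if @choice.unpickle (nat * nat)%type n is Some (k, j) then s k j else 0%N.

Lemma bjoinK s k : bsect k (bjoin s) = s k.
Proof. by apply/funext => j; rewrite /bsect /bjoin choice.pickleK. Qed.

Lemma agree_bsect k n : exists m, forall s t, agree m s t ->
  agree n (bsect k s) (bsect k t).
Proof.
exists (\max_(j < n) (@choice.pickle (nat * nat)%type (k, j : nat)).+1)%N => s t st j jn.
apply: st; pose F := fun j : 'I_n => (@choice.pickle (nat * nat)%type (k, j : nat)).+1.
exact: (@leq_bigmax _ F (Ordinal jn)).
Qed.

Lemma bcont_bsect k g : bcont g -> bcont (g \o bsect k).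
Proof.
move=> cg s i n; have [m mP] := cg (bsect k s) i n.
by have [m' m'P] := agree_bsect k m; exists m' => t /m'P/mP.
Qed.

(** The first entry of a code names the set [A n], the rest codes a point of it. *)
Lemma analytic_exN (A : nat -> set env) : (forall n, analytic (A n)) ->
  analytic (fun w => exists n, A n w).
Proof.
move=> /choice[D] /choice[g] gP.
pose sh (s : nat -> nat) : nat -> nat := fun i => s i.+1.
exists (fun s => D (s 0%N) (sh s)), (fun s => g (s 0%N) (sh s)); split.
- move=> s sP; have [DC _ _] := gP (s 0%N); apply: DC => n.
  have [t [Dt st]] := sP n.+1; exists (sh t); split.
    by rewrite (st 0%N).
  by move=> i lin; exact: st.
- move=> s i n; have [_ gC _] := gP (s 0%N); have [m mP] := gC (sh s) i n.
  exists m.+1 => t st; rewrite -(st 0%N)//; apply: mP => j jm; exact: st.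
- apply/seteqP; split=> [w [n]|w [s Ds <-]].
    have [_ _ ->] := gP n => -[s Ds <-].
    by exists (fun i => if i is j.+1 then s j else n).
  by exists (s 0%N); have [_ _ ->] := gP (s 0%N); exists (sh s).
Qed.

Lemma bclosed_eq (f g : (nat -> nat) -> env) : bcont f -> bcont g ->
  bclosed (fun s => f s = g s).
Proof.
move=> cf cg s sP; apply/funext => i; apply: (@pball_eq _ P) => n.
have [m mP] := cf s i n.+1; have [m' m'P] := cg s i n.+1.
have [t [e st]] := sP (maxn m m').
apply: (@pball_trans _ P n _ (f t i)).
  by apply: mP; apply: agree_le st; exact: leq_maxl.
rewrite e; apply/pball_sym/m'P; apply: agree_le st; exact: leq_maxr.
Qed.

(** A code joins countably many codes, one for each [A k], under the closed condition that all of
    them yield the same point. *)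
Lemma analytic_allN (A : nat -> set env) : (forall n, analytic (A n)) ->
  analytic (fun w => forall n, A n w).
Proof.
move=> /choice[D] /choice[g] gP.
exists (fun s => forall k, D k (bsect k s) /\ g k (bsect k s) = g 0%N (bsect 0 s)).
exists (g 0%N \o bsect 0); split.
- move=> s sP k; split.
    have [DC _ _] := gP k; apply: DC => n.
    have [m mP] := agree_bsect k n; have [t [Dt st]] := sP m.
    by exists (bsect k t); split; [exact: (Dt k).1|exact: mP].
  apply: (bclosed_eq (f := g k \o bsect k) (g := g 0%N \o bsect 0)).
  + by apply: bcont_bsect; have [] := gP k.
  + by apply: bcont_bsect; have [] := gP 0%N.
  + move=> n; have [t [Dt st]] := sP n; exists t; split=> //; exact: (Dt k).2.
- by apply: bcont_bsect; have [] := gP 0%N.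
- apply/seteqP; split=> [w Aw|w [s Ds <-] k].
    have /choice[s sP] : forall k, exists s, D k s /\ g k s = w.
      by move=> k; have := Aw k; have [_ _ ->] := gP k => -[s Ds <-]; exists s.
    exists (bjoin s); last by rewrite /= bjoinK (sP 0%N).2.
    by move=> k; rewrite !bjoinK (sP k).2 (sP 0%N).2; split=> //; exact: (sP k).1.
  by have [_ _ ->] := gP k; exists (bsect k s); [exact: (Ds k).1|exact: (Ds k).2].
Qed.

(* Moving to the next dense point named by s only if this keeps the sequence
   Cauchy makes [decode] below a total function on the Baire space. *)
Fixpoint approx (s : nat -> nat) (n : nat) : V :=
  if n is m.+1 then
    let x := dense_seq P (s n) in
    if `[< pball m (approx s m) x >] then x else approx s m
  else dense_seq P (s 0%N).

Lemma approx_pball s n : pball n (approx s n) (approx s n.+1).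
Proof.
by rewrite /=; case: asboolP => // _; exact: pball_refl.
Qed.

Definition decode (s : nat -> nat) : V := sval (cid (pball_complete (approx_pball s))).

Lemma decodeP s n : pball n (approx s n.+2) (decode s).
Proof. by rewrite /decode; case: cid. Qed.

Lemma agree_approx n s t : agree n.+1 s t -> approx s n = approx t n.
Proof.
elim: n => [|n IH] st; first by rewrite /= st.
have st' : agree n.+1 s t by apply: agree_le st.
by rewrite /= !(IH st') (st n.+1).
Qed.

Lemma decode_cont n s t : agree n.+4 s t -> pball n (decode s) (decode t).
Proof.
move=> st; apply: pball_trans (decodeP t n.+1); apply: pball_sym.
by rewrite -(agree_approx st); exact: decodeP.
Qed.

(** Consecutive named points are both close to [x], so the test in [approx] never fails. *)
Lemma decode_dense x s : (forall n, pball n.+1 x (dense_seq P (s n))) -> decode s = x.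
Proof.
move=> sx; have as_ n : approx s n = dense_seq P (s n).
  elim: n => //= n ->; case: asboolP => // -[].
  apply: (@pball_trans _ P n _ x); first exact/pball_sym/sx.
  by apply: pball_mono (sx n.+1); exact: leqnSn.
apply: (@pball_eq _ P) => n; apply: pball_sym.
apply: (@pball_trans _ P n _ (approx s n.+3)); last exact: decodeP.
by rewrite as_; apply: pball_mono (sx n.+3); lia.
Qed.

Lemma decode_surj x : exists s, decode s = x.
Proof.
have /choice[s sP] : forall n, exists i, pball n.+1 x (dense_seq P i).
  by move=> n; exact: pball_dense.
by exists s; exact: decode_dense.
Qed.

Definition env_decode (s : nat -> nat) : env := fun i => decode (bsect i s).

Lemma env_decode_cont : bcont env_decode.
Proof.
move=> s i n; have [m mP] := agree_bsect i n.+4; exists m => t /mP.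
exact: decode_cont.
Qed.

Lemma env_decode_surj w : exists s, env_decode s = w.
Proof.
have /choice[s sP] : forall i, exists s, decode s = w i by move=> i; exact: decode_surj.
by exists (bjoin s); apply/funext => i; rewrite /env_decode bjoinK.
Qed.

Definition p_closed (F : set V) :=
  forall x, (forall n, exists y, F y /\ pball n x y) -> F x.

Lemma analytic_closed i F : p_closed F -> analytic (fun w => F (w i)).
Proof.
move=> cF; exists (fun s => F (env_decode s i)), env_decode; split.
- move=> s sP; apply: cF => n; have [m mP] := env_decode_cont s i n.
  by have [t [Ft st]] := sP m; exists (env_decode t i); split=> //; exact: mP.
- exact: env_decode_cont.
- apply/seteqP; split=> [w Fw|w [s Fs <-]//].
  by have [s sw] := env_decode_surj w; exists s; rewrite ?sw.
Qed.

Lemma closedC U : p_open U -> p_closed (fun x => ~ U x).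
Proof.
move=> oU x xP /oU[n nP]; have [y [nUy /nP Uy]] := xP n; exact: nUy.
Qed.

Lemma open_exN U : p_open U -> exists F : nat -> set V,
  (forall n, p_closed (F n)) /\ U = (fun x => exists n, F n x).
Proof.
move=> oU; exists (fun n x => forall y, pball n x y -> U y); split.
  move=> n x xP y xy; have [m mP] := pball_open xy; have [z [zP xz]] := xP m.
  exact/zP/mP.
apply/funext => x; apply/propext; split; first exact: oU.
by move=> [n]; apply; exact: pball_refl.
Qed.

(** The induction carries a set and its complement together, because analytic sets are not closed
    under complements. *)
Lemma analytic_bor A : bor A -> analytic A.
Proof.
move=> bA; suff [] : analytic A /\ analytic (fun w => ~ A w) by [].
elim: bA => {A} [_ [i [U [oU ->]]]||A _ [aA aN]|F _ /all_and2[aF aN]].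
- split; last first. exact: (analytic_closed i (closedC oU)).
  have [F [cF ->]] := open_exN oU.
  by apply: analytic_exN => n; exact: (analytic_closed i (cF n)).
- split; first by apply: (@analytic_closed 0%N (fun=> False)) => x /(_ 0%N)[y []].
  by apply: (@analytic_closed 0%N (fun=> ~ False)) => x _ [].
- split=> //.
  by rewrite (_ : (fun w => _) = A)//; apply/funext => w; apply/propext; rewrite notE.
- split; first exact: analytic_exN.
  rewrite (_ : (fun w => _) = (fun w => forall n, ~ F n w)); first exact: analytic_allN.
  by apply/funext => w; apply/propext; rewrite -forallNE.
Qed.

Lemma analytic_tail A : analytic A -> analytic (fun w => exists x, A (econs x w)).
Proof.
move=> [D [g [cD cg ->]]]; exists D, (fun s i => g s i.+1); split=> //.
apply/seteqP; split=> [w [x [s Ds sw]]|w [s Ds <-]].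
  by exists s => //; rewrite sw.
by exists (g s 0%N), s => //; apply/funext => -[].
Qed.

Definition separated (A B : set env) :=
  exists S, [/\ bor S, (forall w, A w -> S w) & (forall w, B w -> ~ S w)].

Lemma separated_exN (A B : nat -> set env) :
  (forall i j, separated (A i) (B j)) ->
  separated (fun w => exists i, A i w) (fun w => exists j, B j w).
Proof.
move=> AB.
have /choice[S SP] : forall ij : nat * nat, exists S, [/\ bor S,
  (forall w, A ij.1 w -> S w) & (forall w, B ij.2 w -> ~ S w)].
  by move=> [i j]; exact: AB.
exists (fun w => exists i, forall j, S (i, j) w); split.
- by apply: sg_exN => i; apply: sg_allN => j; have [] := SP (i, j).
- by move=> w [i Aw]; exists i => j; have [_ + _] := SP (i, j); exact.
- by move=> w [j Bw] [i /(_ j)]; have [_ _] := SP (i, j); exact.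
Qed.

Lemma separated_sub (A A' B B' : set env) :
  (forall w, A w -> A' w) -> (forall w, B w -> B' w) ->
  separated A' B' -> separated A B.
Proof. by move=> AA BB [S [bS AS BS]]; exists S; split=> // w; [move/AA/AS|move/BB/BS]. Qed.

(** If the images are inseparable, so are those of some pair of cylinders one entry longer;
    iterating yields branches [s] and [t]. They lie in the closed domains, and where their images
    differ a ball separates the images of long cylinders. *)
Lemma lusin_separation (A B : set env) : analytic A -> analytic B ->
  (forall w, A w -> ~ B w) -> separated A B.
Proof.
move=> [D [g [cD cg ->]]] [E [h [cE ch ->]]] dis; apply: contrapT => nsep.
pose im (g : (nat -> nat) -> env) (D : set (nat -> nat)) n s : set env :=
  fun w => exists t, [/\ D t, agree n s t & g t = w].
have split_im g' D' n s w : im g' D' n s w -> exists k,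
    im g' D' n.+1 (fun i => if (i < n)%N then s i else k) w.
  move=> [t [Dt st <-]]; exists (t n), t; split=> // i.
  by rewrite ltnS leq_eqVlt => /orP[/eqP->|lin]; rewrite ?ltnn// lin st.
pose bad (x : nat * ((nat -> nat) * (nat -> nat))) :=
  ~ separated (im g D x.1 x.2.1) (im h E x.1 x.2.2).
have step (x : {x | bad x}) : {y : {x | bad x} | [/\ (sval y).1 = (sval x).1.+1,
    agree (sval x).1 (sval x).2.1 (sval y).2.1 &
    agree (sval x).1 (sval x).2.2 (sval y).2.2]}.
  apply: cid; case: x => -[n [s t]] bx /=; apply: contrapT => nx; apply: bx => /=.
  apply: (@separated_sub _ _ _ _ (split_im g D n s) (split_im h E n t)).
  apply: separated_exN => i j; apply: contrapT => sep; apply: nx.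
  exists (exist bad (n.+1, ((fun k => if (k < n)%N then s k else i),
    (fun k => if (k < n)%N then t k else j))) sep) => /=.
  by split=> // k kn; rewrite kn.
have bad0 : bad (0%N, ((fun=> 0%N), (fun=> 0%N))).
  apply: contra_not nsep; apply: separated_sub => w [s Ds <-]; exists s; split=> //.
pose F := fix F n := if n is m.+1 then sval (step (F m)) else exist bad _ bad0.
have FP n : [/\ (sval (F n.+1)).1 = (sval (F n)).1.+1,
    agree (sval (F n)).1 (sval (F n)).2.1 (sval (F n.+1)).2.1 &
    agree (sval (F n)).1 (sval (F n)).2.2 (sval (F n.+1)).2.2] := svalP (step (F n)).
have F1 n : (sval (F n)).1 = n.
  by elim: n => // n IH; have [-> _ _] := FP n; rewrite IH.
pose s i := (sval (F i.+1)).2.1 i; pose t i := (sval (F i.+1)).2.2 i.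
have Fmono i k : agree i (sval (F i)).2.1 (sval (F (i + k)%N)).2.1 /\
                 agree i (sval (F i)).2.2 (sval (F (i + k)%N)).2.2.
  elim: k => [|k [IH1 IH2]]; first by rewrite addn0.
  have [_] := FP (i + k)%N; rewrite (F1 (i + k)%N) addnS => a1 a2; split.
    by apply: agree_trans IH1 _; apply: agree_le a1; exact: leq_addr.
  by apply: agree_trans IH2 _; apply: agree_le a2; exact: leq_addr.
have sF n : agree n s (sval (F n)).2.1.
  by move=> i lin; rewrite /s; have [+ _] := Fmono i.+1 (n - i.+1)%N; rewrite subnKC//; apply.
have tF n : agree n t (sval (F n)).2.2.
  by move=> i lin; rewrite /t; have [_] := Fmono i.+1 (n - i.+1)%N; rewrite subnKC//; apply.
have nsepn n : ~ separated (im g D n s) (im h E n t).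
  have := svalP (F n); rewrite /bad F1; apply: contra_not.
  apply: separated_sub => w [u [Du su <-]]; exists u; split=> //.
    exact: agree_trans (sF n) su.
  exact: agree_trans (tF n) su.
(* If no element of [D] agreed with [s] up to [n], the image of the cylinder would be empty, hence
   separated by the empty set. *)
have Ds : D s.
  apply: cD => n; apply: contrapT => nt; apply: (nsepn n).
  exists (fun=> False); split=> [|w [u [Du su _]]|w _ []]; first exact: sg_cst.
  by apply: nt; exists u.
have Et : E t.
  apply: (cE t) => k; apply: contrapT => nt; apply: (nsepn k).
  exists (fun=> True); split=> [|//|w [u [Du su _]] _]; first exact: sg_cst.
  by apply: nt; exists u.
have [i [n gh]] : exists i n, ~ pball n (g s i) (h t i).
  apply: contrapT => /forallNP H; apply: (dis (g s)); first by exists s.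
  exists t => //; apply/funext => i; apply: esym; apply: (@pball_eq _ P) => n.
  by have /forallNP/(_ n)/contrapT := H i.
have [m mP] := cg s i n.+1; have [m' m'P] := ch t i n.+1.
apply: (nsepn (maxn m m')); exists (fun w => pball n.+1 (g s i) (w i)); split.
- exact: bor_pball.
- by move=> w [u [_ su <-]]; apply: mP; apply: agree_le su; exact: leq_maxl.
- move=> w [u [_ tu <-]] c; apply: gh; apply: (pball_trans c).
  by apply/pball_sym/m'P; apply: agree_le tu; exact: leq_maxr.
Qed.


(** An open condition on a decoded point is decided by a finite prefix of the code, and there are
    countably many prefixes. *)
Lemma bor_decode (u : env -> nat -> nat) (U : set V) :
  (forall n k, bor (fun w => u w n = k)) -> p_open U ->
  bor (fun w => U (decode (u w))).
Proof.
move=> bu oU.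
pose cyl (s : seq nat) w := forall i, (i < size s)%N -> u w i = nth 0%N s i.
have -> : (fun w => U (decode (u w))) = (fun w => exists s : seq nat,
    (forall t, agree (size s) (nth 0%N s) t -> U (decode t)) /\ cyl s w).
  apply/funext => w; apply/propext; split=> [/oU[n nP]|[s [sU sw]]]; last by apply: sU => i /sw.
  exists (mkseq (u w) n.+4); split.
    move=> t; rewrite size_mkseq => ut; apply: nP; apply: decode_cont => i iN.
    by rewrite -ut// nth_mkseq.
  by move=> i; rewrite size_mkseq => iN; rewrite nth_mkseq.
apply: sg_exC => s; apply: sg_and; first exact: sg_cst.
by apply: sg_allN => i; apply: sg_imp; [exact: sg_cst|exact: bu].
Qed.

(* A Borel set with at most one point in each fibre has a Borel projection:
   separating the fibres' points in a basic ball from those outside it yields a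
   Borel code of the only possible witness. *)
Lemma bor_ex_unique (A : set env) : bor A ->
  (forall w x y, A (econs x w) -> A (econs y w) -> x = y) ->
  bor (fun w => exists x, A (econs x w)).
Proof.
move=> bA uA.
have /choice[S SP] : forall ni : nat * nat, exists S, [/\ bor S,
    (forall w, (exists x, A (econs x w) /\ pball ni.1.+1 (dense_seq P ni.2) x) -> S w) &
    (forall w, (exists x, A (econs x w) /\ ~ pball ni.1.+1 (dense_seq P ni.2) x) -> ~ S w)].
  move=> [n i] /=.
  apply: lusin_separation.
  - apply: (@analytic_tail (fun w => A w /\ pball n.+1 (dense_seq P i) (w 0%N))).
    by apply/analytic_bor/sg_and => //; exact: bor_pball.
  - apply: (@analytic_tail (fun w => A w /\ ~ pball n.+1 (dense_seq P i) (w 0%N))).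
    by apply/analytic_bor/sg_and => //; apply: sgN; exact: bor_pball.
  - by move=> w [x [Ax cx]] [y [Ay cy]]; apply: cy; rewrite -(uA _ _ _ Ax Ay).
pose first n w k := S (n, k) w /\ forall j, (j < k)%N -> ~ S (n, j) w.
(* For each [n], this picks the first dense point whose ball is declared by [S] to contain the
   witness. The default 0 is taken only if there is no such ball, which excludes a witness. *)
pose code w n := xget 0%N (first n w).
have first_ex n w i : S (n, i) w -> exists k, first n w k.
  move=> Si; have ex : exists k, `[< S (n, k) w >] by exists i; apply/asboolP.
  exists (ex_minn ex); case: ex_minnP => k /asboolP Sk kmin; split=> // j jk /asboolP /kmin.
  by rewrite leqNgt jk.
have first_uniq n w k l : first n w k -> first n w l -> k = l.
  move=> [Sk mk] [Sl ml]; apply/eqP; rewrite eqn_leq.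
  by apply/andP; split; rewrite leqNgt; apply/negP; [move=> /mk|move=> /ml].
have bfirst n k : bor (fun w => first n w k).
  apply: sg_and; first by have [] := SP (n, k).
  apply: sg_allN => j; apply: sg_imp; first exact: sg_cst.
  by apply: sgN; have [] := SP (n, j).
have bcode n (k : nat) : bor (fun w => code w n = k).
  rewrite (_ : (fun w => _) = (fun w => first n w k \/ (0%N = k /\ ~ exists l, first n w l))).
    apply: sg_or; first exact: bfirst.
    apply: sg_and; first exact: sg_cst.
    by apply/sgN/sg_exN => l; exact: bfirst.
  apply/funext => w; apply/propext; rewrite /code; split.
    case: xgetP => [l -> fl <-|nf <-]; [by left|right; split=> // -[l]; exact: nf].
  case: xgetP => [l -> fl [fk|[_ nfl]]|nf [/nf//|[]//]]; first exact: first_uniq fl fk.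
  by case: nfl; eexists; exact: fl.
have bg : bor (fun w => A (econs (decode (code w)) w)).
  apply: (@bor_subst (fun w => econs (decode (code w)) w)) => // -[|i] U oU.
    exact: bor_decode.
  exact: bor_open.
rewrite (_ : (fun w => _) = (fun w => A (econs (decode (code w)) w)))//.
apply/funext => w; apply/propext; split=> [[x Ax]|]; last by exists (decode (code w)).
suff -> : decode (code w) = x by [].
apply: decode_dense => n.
have [i xi] := pball_dense P n.+1 x; have ci := pball_sym xi.
have [k fk] : exists k, first n w k.
  by apply: (first_ex _ _ i); have [_ + _] := SP (n, i); apply; exists x.
have -> : code w n = k.
  by rewrite /code; case: xgetP => [l -> fl|/(_ k)//]; exact: first_uniq fl fk.
apply: contrapT => nc; have [_ _] := SP (n, k); move=> /(_ w); apply; last exact: fk.1.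
by exists x; split=> // c; apply/nc/pball_sym.
Qed.

(** * Quantifiers with boundedly many witnesses *)

Definition basic (c : nat * nat) (x : V) : Prop := pball c.1 (dense_seq P c.2) x.

Lemma bor_basic c i : bor (fun w => basic c (w i)).
Proof. exact: bor_pball. Qed.

Lemma basic_separates (x : V) (s : seq V) : x \notin s ->
  exists c, basic c x /\ forall y, y \in s -> ~ basic c y.
Proof.
move=> xs; have [n nP] : exists n, forall y, y \in s -> ~ pball n x y.
  elim: s xs => [|y s IH]; first by exists 0%N.
  rewrite inE negb_or => /andP[xy /IH[n nP]].
  have [m mP] : exists m, ~ pball m x y.
    apply: contrapT => /forallNP H; move/eqP: xy; apply; apply: (@pball_eq _ P) => m.
    exact: contrapT.
  exists (maxn m n) => z; rewrite inE => /orP[/eqP ->|/nP nz].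
    by apply: contra_not mP; apply: pball_mono; exact: leq_maxl.
  by apply: contra_not nz; apply: pball_mono; exact: leq_maxr.
have [i ci] := pball_dense P n.+1 x.
exists (n.+1, i); split; first exact: pball_sym.
by move=> y /nP nc cy; apply: nc; exact: pball_trans ci cy.
Qed.

Lemma bor_neq i j : bor (fun w => w i <> w j).
Proof.
rewrite (_ : (fun w => _) = (fun w => exists c, basic c (w i) /\ ~ basic c (w j))).
  apply: sg_exC => c; apply: sg_and; first exact: bor_basic.
  by apply: sgN; exact: bor_basic.
apply/funext => w; apply/propext; split=> [/eqP ij|[c [ci cj]] ij]; last first.
  by apply: cj; rewrite -ij.
have wij : w i \notin [:: w j] by rewrite inE.
have [c [ci cj]] := basic_separates wij.
by exists c; split=> //; apply: cj; rewrite inE.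
Qed.

Lemma bor_eq i j : bor (fun w => w i = w j).
Proof.
rewrite (_ : (fun w => _) = (fun w => ~ w i <> w j)); first exact/sgN/bor_neq.
by apply/funext => w; apply/propext; rewrite notE.
Qed.

Definition fibre_bound (m : nat) (Q : V -> Prop) :=
  exists s : seq V, (size s <= m)%N /\ forall x, Q x -> x \in s.

Lemma fibre_bound_sub m (Q Q' : V -> Prop) : (forall x, Q x -> Q' x) ->
  fibre_bound m Q' -> fibre_bound m Q.
Proof. by move=> QQ [s [sm sP]]; exists s; split=> // x /QQ/sP. Qed.

(** Some basic ball isolates a witness [x] from the others, and [x] is then unique for that ball, so
    [bor_ex_unique] applies. That no second witness lies in the ball is Borel by induction, since
    the fibre without [x] has one point less. *)
Lemma bor_ex m (A : V -> env -> Prop) :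
  bor (fun w => A (w 0%N) (fun i => w i.+1)) ->
  (forall w, fibre_bound m (fun y => A y w)) ->
  bor (fun w => exists x, A x w).
Proof.
elim: m A => [|m IH] A bA fA.
  rewrite (_ : (fun w => _) = (fun=> False)); first exact: sg_False.
  apply/funext => w; apply/propext; split=> // -[x Ax].
  by have [[|y s] [sz sP]] := fA w; have := sP _ Ax.
pose C c x w := A x w /\ basic c x.
pose C2 c y (w : env) := [/\ C c y (fun i => w i.+1), C c (w 0%N) (fun i => w i.+1) & y <> w 0%N].
have bC c : bor (fun w => C c (w 0%N) (fun i => w i.+1)).
  by apply: sg_and => //; exact: bor_basic.
have bC2 c : bor (fun w => exists y, C2 c y w).
  apply: IH => [|w].
    rewrite (_ : (fun w => _) = (fun w => (C c (w 0%N) (fun i => w i.+2) /\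
      C c (w 1%N) (fun i => w i.+2)) /\ w 0%N <> w 1%N)); last first.
      by apply/funext => w; apply/propext; split=> [[]|[[]]].
    apply: sg_and; last exact: bor_neq.
    apply: sg_and; last exact: (bor_reindex S (bC c)).
    (* Variable 1 is the first witness and is skipped; variable 0 is the second. *)
    exact: (bor_reindex (fun i => if i is j.+1 then j.+2 else 0%N) (bC c)).
  have [s [sm sP]] := fA (fun i => w i.+1).
  have [Aw|nAw] := pselect (A (w 0%N) (fun i => w i.+1)); last first.
    by exists [::]; split=> // y [_ [] /nAw].
  exists (rem (w 0%N) s); split.
    by rewrite size_rem ?sP//; case: (s) sm.
  move=> y [[/sP ys _] _ /eqP yw].
  by have := perm_mem (perm_to_rem (sP _ Aw)) y; rewrite ys inE (negbTE yw) /= => <-.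
pose D c x w := C c x w /\ ~ exists y, C2 c y (econs x w).
rewrite (_ : (fun w => _) = (fun w => exists c, exists x, D c x w)).
  apply: sg_exC => c; apply: (@bor_ex_unique (fun w => D c (w 0%N) (fun i => w i.+1))).
    apply: sg_and => //; apply: sgN.
    rewrite (_ : (fun w => _) = (fun w => exists y, C2 c y w))//.
  move=> w x y [Cx nx] [Cy _]; apply: contrapT => xy; apply: nx; exists y; split=> // yx.
  exact/xy/esym.
apply/funext => w; apply/propext; split=> [[x Ax]|[c [x [[Ax _] _]]]]; last by exists x.
have [s [_ sP]] := fA w.
have [|c [cx cs]] := @basic_separates x [seq y <- s | y != x].
  by rewrite mem_filter eqxx.
exists c, x; split=> // -[y [[Ay cy] _ /eqP yx]].
by apply: (cs y) => //; rewrite mem_filter yx; exact: sP.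
Qed.

Lemma bor_all m (Q A : V -> env -> Prop) :
  bor (fun w => Q (w 0%N) (fun i => w i.+1)) ->
  bor (fun w => A (w 0%N) (fun i => w i.+1)) ->
  (forall w, fibre_bound m (fun y => Q y w)) ->
  bor (fun w => forall x, Q x w -> A x w).
Proof.
move=> bQ bA fQ.
rewrite (_ : (fun w => _) = (fun w => ~ exists x, Q x w /\ ~ A x w)).
  apply: sgN; apply: (@bor_ex m (fun x w => Q x w /\ ~ A x w)).
    by apply: sg_and => //; exact: sgN.
  by move=> w; apply: fibre_bound_sub (fQ w) => x [].
apply/funext => w; apply/propext; split=> [QA [x [/QA//]]|nQA x Qx].
by apply: contrapT => nA; apply: nQA; exists x.
Qed.

Definition atleast (Q : V -> Prop) (k : nat) :=
  exists s : seq V, [/\ uniq s, size s = k & forall x, x \in s -> Q x].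

(** Induction on [k]: one point of the fibre is chosen and the remaining ones are required to differ
    from it. *)
Lemma bor_atleast m k (A : V -> env -> Prop) :
  bor (fun w => A (w 0%N) (fun i => w i.+1)) ->
  (forall w, fibre_bound m (fun y => A y w)) ->
  bor (fun w => atleast (fun y => A y w) k).
Proof.
elim: k A => [|k IH] A bA fA.
  rewrite (_ : (fun w => _) = (fun=> True)); first exact: sg_cst.
  by apply/funext => w; apply/propext; split=> // _; exists [::].
pose A' y (w : env) := A y (fun i => w i.+1) /\ y <> w 0%N.
rewrite (_ : (fun w => _) = (fun w => exists x, A x w /\ atleast (fun y => A' y (econs x w)) k)).
  apply: (@bor_ex m (fun x w => A x w /\ atleast (fun y => A' y (econs x w)) k)); last first.
    by move=> w; apply: fibre_bound_sub (fA w) => x [].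
  apply: sg_and => //; rewrite (_ : (fun w => _) = (fun w => atleast (fun y => A' y w) k)); last first.
    by apply/funext => w; rewrite (_ : econs _ _ = w)//; apply/funext => -[].
  apply: IH => [|w]; last by apply: fibre_bound_sub (fA (fun i => w i.+1)) => x [].
  apply: sg_and; last exact: bor_neq.
  exact: (bor_reindex (fun i => if i is j.+1 then j.+2 else 0%N) bA).
apply/funext => w; apply/propext; split=> [[[|x s] [//= /andP[xs us] [sk] sP]]|].
  exists x; split; first by apply: sP; rewrite mem_head.
  exists s; split=> // y ys; split; first by apply: sP; rewrite inE ys orbT.
  by move=> /= yx; rewrite -yx ys in xs.
move=> [x [Ax [s [us sk sP]]]]; exists (x :: s); split=> /=.
- by rewrite us andbT; apply/negP => xs; have [_] := sP _ xs.
- by rewrite sk.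
- by move=> y; rewrite inE => /orP[/eqP->//|ys]; have [] := sP _ ys.
Qed.

End Polish.

(** * The Polish structure of a standard Borel space *)

Section PolishOfMetric.
Variables (R : realType) (M : metricType R) (V : Type) (f : V -> M).
Local Open Scope ring_scope.

Let d := @mdist R M.
Let e2 (n : nat) : R := 2^-1 ^+ n.

Let e2_gt0 n : 0 < e2 n. Proof. by rewrite exprn_gt0. Qed.

Let e2S n : e2 n = e2 n.+1 + e2 n.+1.
Proof. by rewrite /e2 exprS; lra. Qed.

Let e2_small (e : R) : 0 < e -> exists n, e2 n < e.
Proof.
move=> e0; have [n _ nP] := near_infty_natSinv_expn_lt (PosNum e0).
by exists n; have := nP n (leqnn n); rewrite /= /e2 div1r exprVn.
Qed.

Definition mclose n (x y : V) := d (f x) (f y) < e2 n.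

Let dC x y : d x y = d y x. Proof. exact: metric_sym. Qed.
Let dT x y z : d x z <= d x y + d y z. Proof. exact: metric_triangle. Qed.

Lemma mclose_refl n x : mclose n x x.
Proof. by rewrite /mclose /d mdistxx. Qed.

Lemma mclose_sym n x y : mclose n x y -> mclose n y x.
Proof. by rewrite /mclose dC. Qed.

Lemma mclose_trans n x y z : mclose n.+1 x y -> mclose n.+1 y z -> mclose n x z.
Proof.
rewrite /mclose => xy yz; apply: le_lt_trans (dT _ (f y) _) _.
by rewrite e2S ltrD.
Qed.

Lemma mclose_eq x y : injective f -> (forall n, mclose n x y) -> x = y.
Proof.
move=> fI xy; apply: fI; apply: mdist_positivity; apply/eqP; rewrite eq_le mdist_ge0 andbT.
rewrite leNgt; apply/negP => /e2_small[n]; apply/negP; rewrite -leNgt; exact/ltW/xy.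
Qed.

Lemma mclose_open n x y : mclose n x y -> exists m, forall z, mclose m x z -> mclose n z y.
Proof.
rewrite /mclose -subr_gt0 => /e2_small[m mP]; exists m => z xz.
by apply: le_lt_trans (dT _ (f x) _) _; rewrite dC; lra.
Qed.

(** The right side is the geometric sum of the bounds 2 ^- j for n <= j < n + k. *)
Lemma mclose_chain (u : nat -> V) : (forall n, mclose n (u n) (u n.+1)) ->
  forall n k, d (f (u n)) (f (u (n + k)%N)) <= 2 * e2 n - 2 * e2 (n + k).
Proof.
move=> uP n; elim=> [|k IH]; first by rewrite addn0 /d mdistxx subrr.
apply: le_trans (dT _ (f (u (n + k)%N)) _) _; rewrite addnS.
have := uP (n + k)%N; rewrite /mclose; have := e2S (n + k); lra.
Qed.

Lemma mclose_complete (u : nat -> V) : complete_space M -> (forall y, exists x, f x = y) ->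
  (forall n, mclose n (u n) (u n.+1)) -> exists l, forall n, mclose n (u n.+2) l.
Proof.
move=> cM fS uP; have ch := mclose_chain uP.
have [] := cM ((f \o u) @ \oo) _.
  apply: cauchy_exP => e e0; have [n nP] : exists n, e2 n < e / 2 by apply: e2_small; lra.
  exists (f (u n)); exists n => // k /= nk; rewrite ballEmdist /= -(subnKC nk).
  by apply: le_lt_trans (ch n _) _; have := e2_gt0 (n + (k - n))%N; lra.
(* The shift by two leaves 2 ^- (n + 1) for the series after [u n.+2] and as much for the approach
   to the limit. *)
move=> l0 ul; have [l le] := fS l0; exists l => n.
have [N _ NP] := ul _ (nbhsx_ballx l0 _ (e2_gt0 n.+1)).
have {}NP : d (f l) (f (u (n.+2 + N)%N)) < e2 n.+1.
  by have := NP (n.+2 + N)%N (leq_addl _ _); rewrite /= ballEmdist -le.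
rewrite /mclose; apply: le_lt_trans (dT _ (f (u (n.+2 + N)%N)) _) _; rewrite [X in _ + X]dC.
have := ch n.+2 N; have := e2S n; have := e2S n.+1; have := e2_gt0 (n.+2 + N); lra.
Qed.

End PolishOfMetric.

(** The metric is pulled back along the bijection. A dense sequence exists only in a nonempty space,
    hence the point [v0]. *)
Lemma standard_borel_polish (R : realType) (V : choiceType) (B : set_system V) (v0 : V) :
  standard_borel R B -> exists P : polish V, B = sgen (p_open P).
Proof.
move=> [M [f [cM [D cD dD] [g fK gK] ->]]].
have fS y : exists x, f x = y by exists (g y).
have [D0|[s]] : D = set0 \/ $|{surjfun [set: nat] >-> D}| by apply/pfcard_geP.
  by have [|y] := dD setT _ openT; [exists (f v0)|rewrite D0 => -[]].
have dns n x : exists i, mclose f n x (g (s i)).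
  pose U := (ball (f x) (2^-1 ^+ n : R))%R.
  have Ux : U (f x) by apply: ballxx; rewrite exprn_gt0.
  have oU : nbhs (f x) U by apply: nbhsx_ballx; rewrite exprn_gt0.
  have [|y [/interior_subset Uy Dy]] := dD (U°) _ (@open_interior _ U); first by exists (f x).
  have [i _ si] := @surj _ _ _ _ s y Dy; exists i.
  by move: Uy; rewrite /mclose /U ballEmdist gK si.
pose P : polish V := (@Polish V (mclose f) (g \o s) (@mclose_refl _ _ _ f) (@mclose_sym _ _ _ f)
  (@mclose_trans _ _ _ f) (fun x y => mclose_eq (can_inj fK))
  (@mclose_open _ _ _ f) dns (fun u => mclose_complete cM fS)).
exists P.
have ballP (x y : V) n : pball P n x y <-> ball (f x) (2^-1 ^+ n : R)%R (f y).
  by rewrite /= /mclose ballEmdist.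
rewrite -sgenE; apply/seteqP; split=> A.
  case=> U bU <-; rewrite setTI; apply: sg_preimage bU => {}U oU; apply: sg_gen => x Ux.
  have /nbhs_ballP[e /= e0 eU] : nbhs (f x) U by apply: open_nbhs_nbhs.
  have [n _ nP] := near_infty_natSinv_expn_lt (PosNum e0).
  exists n => y /ballP xy; apply: eU; apply: le_ball xy.
  by have := nP n (leqnn n); rewrite /= div1r -exprVn => /ltW.
move=> bA; exists (fun y => A (g y)); last first.
  by rewrite setTI; apply/funext => x /=; rewrite fK.
apply: sg_preimage bA => U oU; apply: sg_gen; rewrite openE => y /= /oU[n nP].
apply/nbhs_ballP; exists (2^-1 ^+ n)%R => /=; first by rewrite exprn_gt0.
by move=> z yz; apply/nP/ballP; rewrite !gK.
Qed.

Section BorelTransfer.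
Variables (V : choiceType) (P : polish V).
Local Notation bor := (sgen (env_open P)).
Local Notation B := (sgen (p_open P)).

Lemma bor_unary (A : set V) i : B A -> bor (fun w => A (w i)).
Proof.
move=> bA; apply: (sg_preimage (g := fun w : env V => w i)) bA => U oU; exact: bor_open.
Qed.

Lemma bor_binary (E : V -> V -> Prop) i j :
  prod_borel B B [set uv : V * V | E uv.1 uv.2] -> bor (fun w => E (w i) (w j)).
Proof.
rewrite /prod_borel -sgenE => bE.
apply: (sg_preimage (g := fun w : env V => (w i, w j))) bE => U [X bX [Y bY <-]].
by apply: sg_and; exact: bor_unary.
Qed.

(** A tuple is extended to a valuation by the constant [v0]; conditions on the coordinates from [k]
    on are then constant. *)
Lemma bor_tuple (v0 : V) k (A : set (env V)) : bor A ->
  tuple_borel B [set x : k.-tuple V | A (nth v0 x)].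
Proof.
rewrite /tuple_borel -sgenE => bA.
apply: (sg_preimage (g := fun x : k.-tuple V => nth v0 x)) bA => _ [i [U [oU ->]]].
have [ik|ki] := ltnP i k.
  apply: sg_gen; exists (Ordinal ik), U; split; first exact: sg_gen.
  by apply/funext => x; rewrite /= (tnth_nth v0).
have -> : (fun x : k.-tuple V => U (nth v0 x i)) = (fun=> U v0); last exact: sg_cst.
by apply/funext => x; rewrite nth_default// size_tuple.
Qed.

End BorelTransfer.

(** * Toasts from sparse clusters *)

Section GraphMetric.
Variables (V : choiceType) (E : rel V).

(** A step may stay in place, so these are the closed balls of the graph metric, as [gballE]
    shows. *)
Fixpoint reach (n : nat) (u v : V) : Prop :=
  if n is m.+1 then exists w, (u = w \/ E u w) /\ reach m w v else u = v.

Lemma reach_refl n x : reach n x x.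
Proof. by elim: n => //= n IH; exists x; split=> //; left. Qed.

Lemma reach_cat m n k x y z : reach m x y -> reach n y z -> (m + n <= k)%N -> reach k x z.
Proof.
elim: m k x => [|m IH] k x.
  move=> <- {y}; elim: n k x => [|n IH] [|k] x //=.
  - by move=> <- _; exists x; split; [left|exact: reach_refl].
  - by move=> [w [xw wz]]; rewrite add0n ltnS => nk; exists w; split=> //; exact: IH.
case: k => // k [w [xw wy]] yz mnk; exists w; split=> //; exact: IH.
Qed.

Lemma reach_le m n x y : (m <= n)%N -> reach m x y -> reach n x y.
Proof. by move=> mn xy; apply: reach_cat xy (reach_refl 0 y) _; rewrite addn0. Qed.

Lemma reachP n u v :
  reach n u v <-> exists p, [/\ path E u p, last u p = v & (size p <= n)%N].
Proof.
elim: n u => [|n IH] u /=.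
  split=> [->|[[|x p] [_ //]]]; by exists [::].
split=> [[w [[->|uw] /IH[p [pp pl ps]]]]|[[|w p] [/= pp pl ps]]].
- by exists p; rewrite leqW.
- by exists (w :: p); rewrite /= uw.
- by exists u; split; [left|apply/IH; exists [::]].
- by case/andP: pp => uw pp; exists w; split; [right|apply/IH; exists p].
Qed.

(** Path lengths are integers: when no path has length at most [n], the infimum is at least n +
    1. *)
Lemma gballE (R : realType) (u : V) n : gball R E u n = reach n u.
Proof.
apply/funext => v; apply/propext; rewrite reachP /gball /gdist /=; split; last first.
  move=> [p [pp pl ps]]; apply: (@le_trans _ _ ((size p)%:R%:E : \bar R)%E).
    by apply: ereal_inf_lbound; exists p.
  by rewrite lee_fin ler_nat.
apply: contraPP => /forallNP np; apply/negP; rewrite -ltNge.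
apply: (@lt_le_trans _ _ (n.+1%:R%:E : \bar R)%E); first by rewrite lte_fin ltr_nat.
apply: le_ereal_inf_tmp => _ [p [pp pl] <-]; rewrite lee_fin ler_nat ltnNge.
by apply/negP => ps; apply: (np p).
Qed.

Hypothesis Esym : symmetric E.

Lemma reach_sym n x y : reach n x y -> reach n y x.
Proof.
elim: n x => [|n IH] x /=; first exact: esym.
move=> [w [xw /IH yw]]; apply: (@reach_cat n 1 n.+1 _ w) => //; last by rewrite addn1.
by exists x; split=> //; case: xw => [->|xw]; [left|right; rewrite Esym].
Qed.

End GraphMetric.

Section Chains.
Variables (V : choiceType) (E : rel V) (r : nat).
Hypothesis Esym : symmetric E.
Local Notation reach := (reach E).

(** The points of a chain lie in [H]; the paths of length at most [r] between them may leave it. *)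
Fixpoint chain (H : set V) (l : nat) (x y : V) : Prop :=
  if l is k.+1 then H x /\ exists z, reach r x z /\ chain H k z y else H x /\ x = y.

Definition conn (H : set V) (x y : V) := exists l, chain H l x y.

Lemma conn_refl (H : set V) x : H x -> conn H x x.
Proof. by exists 0%N. Qed.

Lemma conn_step (H : set V) x y z : H x -> reach r x y -> conn H y z -> conn H x z.
Proof. by move=> Hx xy [l yz]; exists l.+1; split=> //; exists y. Qed.

Lemma conn_elim (H I : set V) x y : conn H x y -> I x ->
  (forall y z, conn H x y -> I y -> reach r y z -> H z -> I z) -> I y.
Proof.
move=> [l]; elim: l x => [|l IH] x; first by move=> [_ <-].
move=> [Hx [z [xz zy]]] Ix Istep.
have Hz : H z by case: (l) zy => [|?] [].
apply: (IH z) => // [|u v zu Iu uv Hv].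
  by apply: (Istep x) => //; exact: conn_refl.
apply: (Istep u) => //; exact: conn_step zu.
Qed.

Lemma conn_left (H : set V) x y : conn H x y -> H x.
Proof. by move=> [[|l] []]. Qed.

Lemma conn_right (H : set V) x y : conn H x y -> H y.
Proof. by move=> xy; apply: (conn_elim xy) => //; exact: conn_left xy. Qed.

Lemma conn_trans (H : set V) x y z : conn H x y -> conn H y z -> conn H x z.
Proof.
move=> [l]; elim: l x => [|l IH] x; first by move=> [_ ->].
by move=> [Hx [u [xu uy]]] yz; apply: conn_step xu _ => //; exact: IH.
Qed.

Lemma conn_rstep (H : set V) x y z : conn H x y -> reach r y z -> H z -> conn H x z.
Proof.
move=> xy yz Hz; apply: (conn_trans xy).
by apply: conn_step yz (conn_refl Hz); exact: conn_right xy.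
Qed.

Lemma conn_sym (H : set V) x y : conn H x y -> conn H y x.
Proof.
move=> xy; apply: (conn_elim xy (I := conn H ^~ x)).
  by apply/conn_refl/(conn_left xy).
by move=> u v _ ux uv Hv; apply: conn_step ux => //; exact: reach_sym.
Qed.

Lemma conn_sub (H H' : set V) x y : (forall z, conn H x z -> H' z) ->
  conn H x y -> conn H' x y.
Proof.
move=> HH xy; apply: (conn_elim xy).
  by apply/conn_refl/HH/conn_refl/(conn_left xy).
by move=> u v xu xu' uv Hv; apply: (conn_rstep xu' uv); apply: HH; exact: conn_rstep uv Hv.
Qed.

Lemma conn_or (H Z : set V) x y : conn (fun v => H v \/ Z v) x y ->
  conn H x y \/ exists u, [/\ Z u, conn (fun v => H v \/ Z v) x u & conn (fun v => H v \/ Z v) u y].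
Proof.
set HZ := (fun v => _) => xy.
apply: (conn_elim xy (I := fun y => conn H x y \/ exists u, [/\ Z u, conn HZ x u & conn HZ u y])).
  by case: (conn_left xy) => xP; [left; exact: conn_refl|right; exists x; split=> //;
    apply: conn_refl; right].
move=> u v xu [Hxu|[t [Zt xt tu]]] uv Hv; last first.
  by right; exists t; split=> //; exact: conn_rstep uv Hv.
case: (Hv) => [Hv'|Zv]; first by left; exact: conn_rstep uv Hv'.
right; exists v; split=> //; last exact: conn_refl.
exact: conn_rstep uv Hv.
Qed.

End Chains.

(** * The laminar family of pieces *)

Section ToastOfClusters.
Variables (V : choiceType) (E : rel V) (r : nat).
Hypothesis Esym : symmetric E.
Hypothesis Efin : forall n u, exists s : seq V, forall v, reach E n u v -> v \in s.
Local Notation reach := (reach E).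
Local Notation conn := (conn E r).

(** [Q n] is a partial equivalence relation whose classes are the clusters of level [n]; [Q n x x]
    says that [x] lies in one of them. *)
Variables (Q : nat -> V -> V -> Prop) (a b : nat -> nat).
Hypothesis Qsym : forall n x y, Q n x y -> Q n y x.
Hypothesis Qtrans : forall n x y z, Q n x y -> Q n y z -> Q n x z.
Hypothesis Qreach : forall n x y, Q n x y -> reach (a n) x y.
Hypothesis Qsep : forall n x y, Q n x x -> Q n y y -> reach (b n) x y -> Q n x y.

(** Bounds the r-connected parts of [halo n]. With D the bound at level m, both ends of a chain of
    level m + 1 that meets the fattened clusters lie within m + 2 D + 3 r of one class, whose
    diameter is at most [a m]. *)
Fixpoint chain_diam (n : nat) : nat :=
  if n is m.+1 then (a m + 2 * m + 4 * chain_diam m + 6 * r)%N else 0%N.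

(** The left side is 2 s + D + 2 r for s = n + D + 2 r, with D the chain bound: a chain between
    clusters fattened by s cannot pass from one class to another. *)
Hypothesis b_large : forall n, (2 * n + 3 * chain_diam n + 6 * r <= b n)%N.

Definition clusters n (s : nat) : set V := fun x => exists w, Q n w w /\ reach s w x.

Definition core n (H : set V) : set V := fun x =>
  exists u, clusters n n u /\ conn (fun y => H y \/ clusters n n y) x u.

Fixpoint halo (n : nat) : set V :=
  if n is m.+1 then fun x => halo m x \/ exists y, core m (halo m) y /\ reach r y x
  else fun=> False.

(** [clusters n n] is the set U_n and [stage n] the set H_n of the overview; [covered n] is the
    union of the r-components of H_n that meet U_n. *)
Definition stage n : set V := fun y => halo n y \/ clusters n n y.
Definition covered n : set V := core n (halo n).

(* A chain that leaves a cluster through H can, H having short chains only, only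
   come back to the same cluster. *)
Lemma conn_cluster (H : set V) c s n : (forall x y, conn H x y -> reach c x y) ->
  (2 * s + c + 2 * r <= b n)%N ->
  forall w x y, Q n w w -> reach s w x -> conn (fun y => H y \/ clusters n s y) x y ->
  exists w', Q n w w' /\ reach (s + c + r) w' y.
Proof.
move=> Hc sb w x y Qw wx xy.
(* Invariant along the chain: the current point is in the fattened class, or is joined inside [H] to
   a point one step away from it. *)
suff [[w' [Qw' w'y]]|[w' [z0 [z [Qw' w'z0 z0z /Hc zy]]]]] :
    (exists w', Q n w w' /\ reach s w' y) \/
    (exists w' z0 z, [/\ Q n w w', reach s w' z0, reach r z0 z & conn H z y]).
- by exists w'; split=> //; apply: reach_le w'y; lia.
- exists w'; split=> //; apply: (reach_cat w'z0 (reach_cat z0z zy (leqnn _))); lia.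
apply: (conn_elim xy (I := fun y => (exists w', Q n w w' /\ reach s w' y) \/
    (exists w' z0 z, [/\ Q n w w', reach s w' z0, reach r z0 z & conn H z y]))).
  by left; exists w.
move=> {xy}{}y z _ + yz [Hz|[w2 [Qw2 w2z]]].
  move=> [[w1 [Qw1 w1y]]|[w1 [z0 [z1 [Qw1 w1z0 z0z z1y]]]]]; right.
    by exists w1, y, z; split=> //; exact: conn_refl.
  by exists w1, z0, z1; split=> //; exact: conn_rstep yz Hz.
(* On re-entering a cluster, the old and the new class are at distance at most s + r + c + r + s, so
   they are the same class. *)
move=> D; left; exists w2; split=> //.
have Q1 w1 : Q n w w1 -> Q n w1 w1 by move=> q; apply: Qtrans (Qsym q) q.
have zw2 := reach_sym Esym w2z.
case: D => [[w1 [Qw1 w1y]]|[w1 [z0 [z1 [Qw1 w1z0 z0z /Hc z1y]]]]]; apply: (Qtrans Qw1);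
  apply: Qsep => //; try exact: Q1 Qw1.
- by apply: (reach_cat w1y (reach_cat yz zw2 (leqnn _))); lia.
- apply: (reach_cat w1z0 (reach_cat z0z (reach_cat z1y (reach_cat yz zw2 (leqnn _)) (leqnn _))
    (leqnn _))); lia.
Qed.

Lemma core_reach (H : set V) c n : (forall x y, conn H x y -> reach c x y) ->
  (2 * n + c + 2 * r <= b n)%N -> forall x, core n H x ->
  exists w, [/\ Q n w w & reach (n + c + r) w x].
Proof.
move=> Hc nb x [u [[w [Qw wu]] xu]]; have ux := conn_sym Esym xu.
have [w' [Qw' w'x]] := conn_cluster Hc nb Qw wu ux.
by exists w'; split=> //; exact: Qtrans (Qsym Qw') Qw'.
Qed.

(** What [halo n.+1] adds to [halo n] lies in the clusters fattened by [s]. A chain avoiding these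
    is bounded by induction; one that meets them has both ends near a single class by
    [conn_cluster]. *)
Lemma halo_diam n x y : conn (halo n) x y -> reach (chain_diam n) x y.
Proof.
elim: n x y => [|n IH] x y; first by move=> /conn_left.
have nb := b_large n.
pose s := (n + chain_diam n + 2 * r)%N.
move=> xy; have {xy} : conn (fun v => halo n v \/ clusters n s v) x y.
  apply: conn_sub xy => z /conn_right[|[u [cu uz]]]; first by left.
  right; have [|w [Qw wu]] := core_reach IH _ cu; first by lia.
  by exists w; split=> //; apply: reach_cat wu uz _; rewrite /s; lia.
move=> /conn_or[/IH|[u [[w [Qw wu]] xu uy]]].
  by apply: reach_le => /=; lia.
have ux := conn_sym Esym xu.
have sb : (2 * s + chain_diam n + 2 * r <= b n)%N by rewrite /s; lia.
have [w1 [Q1 w1x]] := conn_cluster IH sb Qw wu ux.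
have [w2 [Q2 w2y]] := conn_cluster IH sb Qw wu uy.
have w12 := Qreach (Qtrans (Qsym Q1) Q2).
apply: (reach_cat (reach_sym Esym w1x) (reach_cat w12 w2y (leqnn _))); rewrite /= /s; lia.
Qed.

Lemma stage_diam n x y : covered n x -> conn (stage n) x y -> reach (chain_diam n.+1) x y.
Proof.
move=> [u [[w [Qw wu]] xu]] xy; have nb := b_large n.
have sb : (2 * n + chain_diam n + 2 * r <= b n)%N by lia.
have ux := conn_sym Esym xu; have uy := conn_trans ux xy.
have [w1 [Q1 w1x]] := conn_cluster (@halo_diam n) sb Qw wu ux.
have [w2 [Q2 w2y]] := conn_cluster (@halo_diam n) sb Qw wu uy.
have w12 := Qreach (Qtrans (Qsym Q1) Q2).
apply: (reach_cat (reach_sym Esym w1x) (reach_cat w12 w2y (leqnn _))); rewrite /=; lia.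
Qed.

(** The r-components of [stage n] that meet [clusters n n], given by conditions whose quantifiers
    range over members of [K], bounded balls and integers, which makes them Borel. *)
Definition pieces n : set {fset V} := fun K =>
  [/\ exists x, x \in K, forall x, x \in K -> covered n x,
      forall x y, x \in K -> reach r x y -> stage n y -> y \in K
    & forall x y, x \in K -> y \in K -> conn (stage n) x y].

Lemma halo_le m n x : (m <= n)%N -> halo m x -> halo n x.
Proof. by move=> /subnK <- Hx; elim: (n - m)%N => //= k IH; left. Qed.

Lemma covered_halo m n x y : (m < n)%N -> covered m x -> reach r x y -> halo n y.
Proof. by move=> mn cx xy; apply: (halo_le mn); right; exists x. Qed.

Lemma covered_conn n x y : covered n x -> conn (stage n) x y -> covered n y.
Proof.
move=> [u [cu xu]] xy; exists u; split=> //.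
by apply: conn_trans xu; exact: conn_sym.
Qed.

Lemma piece_closed n K x y : pieces n K -> x \in K -> conn (stage n) x y -> y \in K.
Proof.
move=> [_ _ Kc _] xK xy; apply: (conn_elim xy (I := fun y => y \in K)) => // u v _ uK uv.
exact: Kc uv.
Qed.

(** Two components of the same stage within distance [r] coincide. A piece of an earlier level lies
    with its r-neighbourhood in [halo n], so it is absorbed by any later piece that this
    neighbourhood meets. *)
Lemma pieces_laminar m n K L : pieces m K -> pieces n L -> (m <= n)%N -> K <> L ->
  (forall x y, x \in K -> reach r x y -> y \notin L) \/
  (forall x y, x \in K -> reach r x y -> y \in L).
Proof.
move=> pK pL; have [[k0 k0K] Kcov Kcl Kconn] := pK; have [_ Lcov Lcl Lconn] := pL.
rewrite leq_eqVlt => /orP[/eqP mn|mn] KL.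
  subst n; left=> x y xK xy; apply/negP => yL; apply: KL.
  have yK : y \in K.
    by apply: Kcl xK xy _; have := Lconn _ _ yL yL; exact: conn_left.
  apply/fsetP => z; apply/idP/idP => zz.
    by apply: (piece_closed pL yL); exact: Kconn.
  by apply: (piece_closed pK yK); exact: Lconn.
have [nx|] := pselect (exists x y, [/\ x \in K, reach r x y & y \in L]); last first.
  by move=> nx; left=> x y xK xy; apply/negP => yL; apply: nx; exists x, y.
right=> x' y' x'K x'y'; case: nx => x [y [xK xy yL]].
have Hs z t : z \in K -> reach r z t -> stage n t.
  by move=> /Kcov zc zt; left; exact: (covered_halo mn zc zt).
have Ks z : z \in K -> stage n z by move=> zK; apply: (Hs z z) => //; exact: reach_refl.
(* The chain from [y] goes to [x], through [K] to [x'], and on to [y']. *)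
apply: (piece_closed pL yL).
apply: (conn_step (y := x)); [exact: (Hs _ _ xK xy)|exact: (reach_sym Esym xy)|].
apply: (@conn_trans _ _ _ _ _ x'); last first.
  by apply: (conn_step (Ks _ x'K) x'y'); apply: conn_refl; exact: (Hs _ _ x'K x'y').
apply: conn_sub (Kconn _ _ xK x'K) => z xz; apply: Ks.
exact: piece_closed pK xK xz.
Qed.

(** The piece is the r-component of [u] in [stage n], finite because its diameter is bounded and
    balls are finite. *)
Lemma pieces_cover n u v : clusters n n u -> clusters n n v -> reach r u v ->
  exists K : {fset V}, [/\ pieces n K, u \in K & v \in K].
Proof.
move=> cu cv uv.
have su : stage n u by right.
have covu : covered n u by exists u; split=> //; exact: conn_refl.
have [s sP] := Efin (chain_diam n.+1) u.
pose K := [fset y in s | `[< conn (stage n) u y >]]%fset.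
have KP y : (y \in K) <-> conn (stage n) u y.
  rewrite !inE /=; split=> [/andP[_ /asboolP]//|uy]; apply/andP; split; last exact/asboolP.
  exact/sP/stage_diam.
have uK : u \in K by apply/KP/conn_refl.
exists K; split=> //; last by apply/KP; apply: (conn_rstep (conn_refl _ _ su) uv); right.
split; first by exists u.
- by move=> x /KP ux; exact: covered_conn ux.
- by move=> x y /KP ux xy sy; apply/KP; exact: conn_rstep xy sy.
- by move=> x y /KP ux /KP uy; apply: conn_trans uy; exact: conn_sym.
Qed.

(** Transfers to the pieces any property of clusters that is constant on components of the graph. *)
Lemma covered_clusters n x : covered n x -> exists k w, Q n w w /\ reach k w x.
Proof.
move=> cx; have nb := b_large n.
have [|w [Qw wx]] := core_reach (@halo_diam n) _ cx; first by lia.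
by exists (n + chain_diam n + r)%N, w.
Qed.

End ToastOfClusters.

(** * Borelness of the pieces *)

Section BorelGraph.
Variables (V : choiceType) (P : polish V) (E : rel V).
Local Notation bor := (sgen (env_open P)).
Local Notation B := (sgen (p_open P)).
Local Notation reach := (reach E).
Hypothesis Esym : symmetric E.
Hypothesis ball_bound : forall n, exists m, forall u, fibre_bound m (reach n u).
Hypothesis bE : forall i j, bor (fun w => E (w i) (w j)).

Lemma bor1 (A : set V) i : bor (fun w => A (w 0%N)) -> bor (fun w => A (w i)).
Proof. exact: (bor_reindex (fun=> i)). Qed.

Lemma bor_reach n i j : bor (fun w => reach n (w i) (w j)).
Proof.
elim: n i j => [|n IH] i j /=; first exact: bor_eq.
have [m mP] := ball_bound 1.
apply: (@bor_ex _ _ m (fun x w => (w i = x \/ E (w i) x) /\ reach n x (w j))).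
  by apply: sg_and => //; apply: sg_or => //; exact: bor_eq.
move=> w; apply: fibre_bound_sub (mP (w i)) => x [wx _].
by exists x.
Qed.

Lemma bor_ex_reach n i (A : V -> env V -> Prop) :
  bor (fun w => A (w 0%N) (fun i => w i.+1)) ->
  bor (fun w => exists x, reach n (w i) x /\ A x w).
Proof.
move=> bA; have [m mP] := ball_bound n.
apply: (@bor_ex _ _ m (fun x w => reach n (w i) x /\ A x w)).
  by apply: sg_and => //; exact: bor_reach.
by move=> w; apply: fibre_bound_sub (mP (w i)) => x [].
Qed.

Lemma bor_all_reach n i (A : V -> env V -> Prop) :
  bor (fun w => A (w 0%N) (fun i => w i.+1)) ->
  bor (fun w => forall x, reach n (w i) x -> A x w).
Proof.
move=> bA; have [m mP] := ball_bound n.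
apply: (@bor_all _ _ m (fun x w => reach n (w i) x)) => //; first exact: bor_reach.
Qed.

Lemma chain_reach r (H : set V) l x y : chain E r H l x y -> reach (l * r) x y.
Proof.
elim: l x => [|l IH] x /=; first by move=> [_ ->].
by move=> [_ [z [xz /IH zy]]]; apply: reach_cat xz zy _; rewrite mulSn.
Qed.

Lemma bor_chain r (H : set V) l i j : bor (fun w => H (w 0%N)) ->
  bor (fun w => chain E r H l (w i) (w j)).
Proof.
move=> bH; elim: l i j => [|l IH] i j /=.
  by apply: sg_and; [exact: bor1|exact: bor_eq].
apply: sg_and; first exact: bor1.
exact: (@bor_ex_reach r i (fun z w => chain E r H l z (w j))).
Qed.

Lemma bor_conn r (H : set V) i j : bor (fun w => H (w 0%N)) ->
  bor (fun w => conn E r H (w i) (w j)).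
Proof. by move=> bH; apply: sg_exN => l; exact: bor_chain. Qed.

Section Pieces.
Variables (r : nat) (Q : nat -> V -> V -> Prop).
Hypothesis bQ : forall n, bor (fun w => Q n (w 0%N) (w 1%N)).

Lemma bor_clusters n s i : bor (fun w => clusters E Q n s (w i)).
Proof.
apply: bor1; rewrite (_ : (fun w => _) = (fun w => exists x, reach s (w 0%N) x /\ Q n x x)).
  apply: (@bor_ex_reach s 0%N (fun x w => Q n x x)).
  exact: (bor_reindex (fun=> 0%N) (bQ n)).
apply/funext => w; apply/propext.
by split=> [[x [Qx /(reach_sym Esym) xw]]|[x [/(reach_sym Esym) xw Qx]]]; exists x.
Qed.

(** A chain of [l] steps ends within distance l r, so fixing [l] bounds the search for its end
    point. *)
Lemma bor_core n (H : set V) i : bor (fun w => H (w 0%N)) ->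
  bor (fun w => core E r Q n H (w i)).
Proof.
move=> bH; set K := (fun y => H y \/ clusters E Q n n y).
have bK : bor (fun w => K (w 0%N)) by apply: sg_or => //; exact: bor_clusters.
apply: bor1; rewrite (_ : (fun w => _) = (fun w => exists l, exists x,
    reach (l * r) (w 0%N) x /\ (clusters E Q n n x /\ chain E r K l (w 0%N) x))).
  apply: sg_exN => l.
  apply: (@bor_ex_reach _ 0%N (fun x w => clusters E Q n n x /\ chain E r K l (w 0%N) x)).
  by apply: sg_and; [exact: bor_clusters|exact: bor_chain].
apply/funext => w; apply/propext; split=> [[x [cx [l lx]]]|[l [x [_ [cx lx]]]]].
  by exists l, x; split=> //; exact: chain_reach lx.
by exists x; split=> //; exists l.
Qed.

Lemma bor_halo n i : bor (fun w => halo E r Q n (w i)).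
Proof.
apply: bor1; elim: n => [|n IH] /=; first exact: sg_False.
apply: sg_or => //.
rewrite (_ : (fun w => _) = (fun w => exists y, reach r (w 0%N) y /\ core E r Q n (halo E r Q n) y)).
  by apply: (@bor_ex_reach _ _ (fun y w => core E r Q n (halo E r Q n) y)); exact: bor_core.
apply/funext => w; apply/propext.
by split=> [[x [Qx /(reach_sym Esym) xw]]|[x [/(reach_sym Esym) xw Qx]]]; exists x.
Qed.

Lemma bor_stage n i : bor (fun w => stage E r Q n (w i)).
Proof. by apply: sg_or; [exact: bor_halo|exact: bor_clusters]. Qed.

Lemma borel_pieces n : borel_finsets B (pieces E r Q n).
Proof.
move=> k; have [->|k0] := posnP k.
  rewrite /tuple_borel -sgenE.
  have -> : [set x : 0.-tuple V | pieces E r Q n [fset y in (x : seq V)]%fset] = (fun=> False).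
    apply/funext => x; apply/propext; split=> // -[[y]]; rewrite !inE /=.
    by rewrite [x]tuple0.
  exact: sg_False.
have [[v0]|nV] := pselect (exists v : V, True); last first.
  rewrite /tuple_borel -sgenE.
  have -> : [set x : k.-tuple V | pieces E r Q n [fset y in (x : seq V)]%fset] = (fun=> False).
    by apply/funext => x; apply/propext; split=> // -[[y] _]; case: nV; exists y.
  exact: sg_False.
(* The conditions of [pieces] for the set listed, possibly with repetitions, by the first [k]
   variables; it is nonempty because [k] is positive. *)
move=> _; pose A := fun w : env V => ((forall i, (i < k)%N -> covered E r Q n (w i)) /\
  (forall i, (i < k)%N -> forall y, reach r (w i) y -> stage E r Q n y ->
     exists j, (j < k)%N /\ y = w j)) /\
  (forall i j, (i < k)%N -> (j < k)%N -> conn E r (stage E r Q n) (w i) (w j)).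
have bA : bor A.
  apply: sg_and; first apply: sg_and.
  - apply: sg_allN => i; apply: sg_imp; first exact: sg_cst.
    by apply: bor_core; exact: bor_halo.
  - apply: sg_allN => i; apply: sg_imp; first exact: sg_cst.
    apply: (@bor_all_reach r i (fun y w => stage E r Q n y -> exists j, (j < k)%N /\ y = w j)).
    apply: sg_imp; first exact: bor_stage.
    by apply: sg_exN => j; apply: sg_and; [exact: sg_cst|exact: bor_eq].
  - apply: sg_allN => i; apply: sg_allN => j; apply: sg_imp; first exact: sg_cst.
    apply: sg_imp; first exact: sg_cst.
    by apply: bor_conn; exact: bor_stage.
have -> : [set x : k.-tuple V | pieces E r Q n [fset y in (x : seq V)]%fset] =
    [set x : k.-tuple V | A (nth v0 x)]; last exact: bor_tuple.
apply/funext => x; apply/propext.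
have memP y : (y \in [fset y in (x : seq V)]%fset) <-> exists j, (j < k)%N /\ y = nth v0 x j.
  rewrite !inE /=; split=> [yx|[j [jk ->]]]; last by rewrite mem_nth// size_tuple.
  exists (index y x); rewrite nth_index//; split=> //.
  by rewrite -[X in (_ < X)%N](size_tuple x) index_mem.
have memn i : (i < k)%N -> nth v0 x i \in [fset y in (x : seq V)]%fset.
  by move=> ik; apply/memP; exists i.
split=> [[_ cov cl con]|[[cov cl] con]].
- split; first split.
  + by move=> i /memn/cov.
  + by move=> i /memn ik y ny sy; apply/memP; exact: cl ny sy.
  + by move=> i j /memn + /memn; exact: con.
- split.
  + by exists (nth v0 x 0%N); exact: memn.
  + by move=> y /memP[j [jk ->]]; exact: cov.
  + by move=> y z /memP[j [jk ->]] yz sz; apply/memP; exact: cl yz sz.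
  + by move=> y z /memP[i [ik ->]] /memP[j [jk ->]]; exact: con.
Qed.

End Pieces.
End BorelGraph.

(** * Sparse clusters from polynomial growth *)

Lemma infinite_pigeonhole (T : nat) (A : nat -> nat -> Prop) :
  (forall N, exists t n, [/\ (t < T)%N, (N <= n)%N & A t n]) ->
  exists t, (t < T)%N /\ forall N, exists n, (N <= n)%N /\ A t n.
Proof.
move=> AP; apply: contrapT => /forallNP nA.
have /choice[f fP] : forall t, exists N, (t < T)%N -> forall n, (N <= n)%N -> ~ A t n.
  move=> t; apply: contrapT => /forallNP H; apply: (nA t); split.
    by apply: contrapT => tT; apply: (H 0%N).
  move=> N; apply: contrapT => nn; apply: (H N) => _ n Nn An; apply: nn; by exists n.
have [t [n [tT Nn]]] := AP (\max_(t < T) f t)%N.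
apply: (fP t tT n) => //; apply: leq_trans Nn.
exact: (@leq_bigmax _ (fun i : 'I_T => f i) (Ordinal tT)).
Qed.

Lemma switch_point (p : nat -> Prop) K : p 0%N -> ~ p K ->
  exists i, [/\ (i < K)%N, p i & ~ p i.+1].
Proof.
elim: K => [//|K IH] p0 npK; have [pK|/(IH p0)[i [iK pi npi]]] := pselect (p K).
  by exists K.
by exists i; split=> //; exact: ltnW.
Qed.

Section Packing.
Variable V : choiceType.

Lemma packing (ys : seq V) (b : V -> {fset V}) (F : {fset V}) v : uniq ys ->
  (forall y, y \in ys -> (v <= #|` b y|)%N /\ {subset b y <= F}) ->
  (forall x y z, x \in ys -> y \in ys -> z \in b x -> z \in b y -> x = y) ->
  (size ys * v <= #|` F|)%N.
Proof.
elim: ys F => [//|y ys IH] F /= /andP[yys uys] bP dis.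
have [vy yF] := bP y (mem_head _ _).
have : (size ys * v <= #|` (F `\` b y)%fset|)%N.
  apply: IH => // [z zys|x z t xys zys]; last by apply: dis; rewrite inE ?xys ?zys orbT.
  have zys' : z \in y :: ys by rewrite inE zys orbT.
  have [vz zF] := bP z zys'; split=> // t tz; rewrite inE zF// andbT.
  apply/negP => ty; move: yys; rewrite (dis y z t) ?zys//; exact: mem_head.
have yF' : (b y `<=` F)%fset by apply/fsubsetP.
have := cardfsDS yF'; have := fsubset_leq_card yF'; rewrite mulSn; lia.
Qed.

Lemma atleast_fset (F : {fset V}) (Q : V -> Prop) k :
  (forall x, x \in F <-> Q x) -> atleast Q k <-> (k <= #|` F|)%N.
Proof.
move=> FQ; split=> [[s [us <- sQ]]|kF].
  by apply: uniq_leq_size => // x /sQ/FQ.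
exists (take k F); split; first exact/take_uniq/fset_uniq.
  by rewrite size_takel.
by move=> x /mem_take/FQ.
Qed.

Lemma atleast_sub (Q Q' : V -> Prop) k : (forall x, Q x -> Q' x) -> atleast Q k -> atleast Q' k.
Proof. by move=> QQ [s [us sk sQ]]; exists s; split=> // x /sQ/QQ. Qed.

(** Applied to the traces of a net at two radii: equal counts force equal traces. *)
Lemma atleast_squeeze (Q Q' : V -> Prop) k : (forall x, Q x -> Q' x) ->
  atleast Q k -> ~ atleast Q' k.+1 -> forall x, Q' x -> Q x.
Proof.
move=> QQ [s [us sk sQ]] nQ x Q'x; have [/sQ//|xs] := boolP (x \in s).
case: nQ; exists (x :: s); split; rewrite /= ?xs ?sk//.
by move=> y; rewrite inE => /orP[/eqP->|/sQ/QQ].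
Qed.

End Packing.

Section Net.
Variables (V : choiceType) (P : polish V) (E : rel V).
Local Notation bor := (sgen (env_open P)).
Local Notation reach := (reach E).
Hypothesis Esym : symmetric E.
Hypothesis ball_bound : forall n, exists m, forall u, fibre_bound m (reach n u).
Hypothesis bE : forall i j, bor (fun w => E (w i) (w j)).

(** Balls being finite, [G] is the union of countably many n-separated Borel sets [C c], where a
    basic ball isolates each point within its n-ball. The net is built greedily, going through these
    sets in turn. *)
Lemma borel_net n (G : set V) : bor (fun w => G (w 0%N)) ->
  exists Y : set V, [/\ bor (fun w => Y (w 0%N)), forall x, Y x -> G x,
    forall x y, Y x -> Y y -> reach n x y -> x = y &
    forall x, G x -> exists y, Y y /\ reach n x y].
Proof.
move=> bG.
pose C c x := G x /\ basic P c x /\ forall y, reach n x y -> basic P c y -> y = x.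
pose acc := fix acc m : set V := if m is k.+1 then fun x => acc k x \/
  ((exists c, choice.pickle c = k /\ C c x) /\ ~ exists y, reach n x y /\ acc k y) else fun=> False.
have bC c : bor (fun w => C c (w 0%N)).
  apply: sg_and => //; apply: sg_and; first exact: bor_basic.
  apply: (@bor_all_reach V P E ball_bound bE n 0%N (fun y w => basic P c y -> y = w 0%N)).
  by apply: sg_imp; [exact: bor_basic|exact: bor_eq].
have bacc m i : bor (fun w => acc m (w i)).
  apply: bor1; elim: m => [|m IH]; first exact: sg_False.
  apply: sg_or => //; apply: sg_and.
    by apply: sg_exC => c; apply: sg_and => //; exact: sg_cst.
  by apply/sgN/(@bor_ex_reach V P E ball_bound bE n 0%N (fun y w => acc m y)).
have accS m k x : (m <= k)%N -> acc m x -> acc k x.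
  by move=> /subnK <- ax; elim: (k - m)%N => //= l IH; left.
have accG m x : acc m x -> G x.
  by elim: m => //= m IH [/IH|[[c [_ []]]]].
have accsep m x y : acc m x -> acc m y -> reach n x y -> x = y.
  elim: m x y => //= m IH x y [ax|[[c [cm Cx]] nx]] [ay|[[c' [cm' Cy]] ny]] xy.
  - exact: IH.
  - by case: ny; exists x; split=> //; exact: reach_sym.
  - by case: nx; exists y.
  (* Points added at the same stage come from one set [C c], which is n-separated. *)
  - have cc : c = c' by apply: (pcan_inj choice.pickleK); rewrite cm.
    subst c'; case: Cx => _ [_ Cx]; case: Cy => _ [cy _]; exact/esym/Cx.
exists (fun x => exists m, acc m x); split.
- by apply: sg_exN.
- by move=> x [m /accG].
- move=> x y [k ak] [m am]; apply: (accsep (maxn k m)).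
    by apply: accS ak; exact: leq_maxl.
  by apply: accS am; exact: leq_maxr.
- move=> x Gx; have [m /(_ x)[s [_ sP]]] := ball_bound n.
  have [|c [cx cs]] := @basic_separates V P x [seq y <- s | y != x].
    by rewrite mem_filter eqxx.
  have [[y [xy ay]]|ny] := pselect (exists y, reach n x y /\ acc (choice.pickle c) y).
    by exists y; split=> //; exists (choice.pickle c).
  exists x; split; last exact: reach_refl.
  exists (choice.pickle c).+1; right; split=> //; exists c; split=> //; split=> //; split=> //.
  move=> y xy cy; apply: contrapT => /eqP yx; apply: (cs y) => //.
  by rewrite mem_filter yx; exact: sP.
Qed.

End Net.

(** * Doubling scales and classes of equal traces *)

Section Scales.
Variables (V : choiceType) (P : polish V) (E : rel V).
Local Notation bor := (sgen (env_open P)).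
Local Notation reach := (reach E).
Hypothesis Esym : symmetric E.
Hypothesis ball_bound : forall n, exists m, forall u, fibre_bound m (reach n u).
Hypothesis bE : forall i j, bor (fun w => E (w i) (w j)).

Definition bal n u : {fset V} := fset_set (reach n u).

Lemma balP n u x : x \in bal n u <-> reach n u x.
Proof.
have [m /(_ u)[s [_ sP]]] := ball_bound n.
have fin : finite_set (reach n u : set V).
  by apply: (@sub_finite_set _ _ [set` s]) => [y /sP//|]; exact: finite_seq.
by rewrite /bal in_fset_set// inE.
Qed.

Lemma bal_gt0 n u : (0 < #|` bal n u|)%N.
Proof.
rewrite cardfs_gt0; apply/fset0Pn; exists u; apply/balP; exact: reach_refl.
Qed.

Variables (d n0 : nat).
Hypothesis bal_growth : forall n u, (n0 <= n)%N -> (#|` bal n u| <= n.+1 ^ d)%N.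

(** Larger than 8 ^ d, the factor gained by a polynomial of degree d when the radius grows
    eightfold, so that doubling cannot fail at all large scales. *)
Let K := (8 ^ d.+1)%N.

Definition doubling k (x : V) : Prop := (#|` bal (8 ^ k.+1) x| <= K * #|` bal (8 ^ k) x|)%N.

Lemma doubling_io x k0 : exists k, (k0 <= k)%N /\ doubling k x.
Proof.
apply: contrapT => /forallNP nd.
pose k1 := (k0 + n0)%N.
have grow j : (K ^ j <= #|` bal (8 ^ (k1 + j)) x|)%N.
  elim: j => [|j IH]; first exact: bal_gt0.
  have : ~ doubling (k1 + j) x by move=> dx; apply: (nd (k1 + j)%N); split=> //; rewrite /k1; lia.
  move=> /negP; rewrite -ltnNge addnS => /ltnW; apply: leq_trans.
  by rewrite (expnS K j) leq_mul2l IH orbT.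
(* The least [j] for which K ^ j exceeds the polynomial bound 8 ^ ((k1 + j + 1) d). *)
pose j := (d * k1.+1).+1.
have k1n : (n0 <= 8 ^ (k1 + j))%N.
  by apply: leq_trans (ltnW (ltn_expl _ _)) => //; rewrite /k1; lia.
have := leq_trans (grow j) (bal_growth x k1n).
apply/negP; rewrite -ltnNge.
have le1 : ((8 ^ (k1 + j)).+1 ^ d <= 8 ^ ((k1 + j).+1 * d))%N.
  rewrite expnM; have [->//|d0] := posnP d.
  rewrite leq_exp2r// expnS; have : (0 < 8 ^ (k1 + j))%N by rewrite expn_gt0.
  lia.
apply: leq_ltn_trans le1 _; rewrite /K -expnM ltn_exp2l// /j; nia.
Qed.

Lemma bor_card_bal n k : bor (fun w => (k <= #|` bal n (w 0%N)|)%N).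
Proof.
have [m mP] := ball_bound n.
rewrite (_ : (fun w => _) = (fun w => atleast (fun y => reach n (w 0%N) y) k)).
  apply: (@bor_atleast V P m k (fun y w => reach n (w 0%N) y)) => [|w]; last exact: mP.
  exact: (bor_reach (P := P) ball_bound bE).
apply/funext => w; apply/propext; split=> [kb|/(atleast_fset _ (balP n (w 0%N)))//].
exact/(atleast_fset _ (balP n (w 0%N))).
Qed.

Lemma bor_doubling k : bor (fun w => doubling k (w 0%N)).
Proof.
(* The two cardinalities are compared through integer thresholds, each of which is a Borel
   condition. *)
rewrite (_ : (fun w => _) = (fun w => forall m,
    (m <= #|` bal (8 ^ k.+1) (w 0%N)|)%N -> exists l, (m <= K * l)%N /\
    (l <= #|` bal (8 ^ k) (w 0%N)|)%N)).
  apply: sg_allN => m; apply: sg_imp; first exact: bor_card_bal.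
  apply: sg_exN => l; apply: sg_and; first exact: sg_cst.
  exact: bor_card_bal.
apply/funext => w; apply/propext; split=> [dw m mb|/(_ _ (leqnn _))[l [le1 le2]]].
  by exists #|` bal (8 ^ k) (w 0%N)|; split=> //; exact: leq_trans mb dw.
by apply: leq_trans le1 _; rewrite leq_mul2l le2 orbT.
Qed.

(* At most K points of a 2s-separated set of doubling points lie in a ball of
   radius 3s: compare volumes inside the 8s-ball of the one with the smallest
   s-ball. *)
Lemma net_multiplicity k (Y : set V) x : (forall y, Y y -> doubling k y) ->
  (forall y z, Y y -> Y z -> reach (2 * 8 ^ k) y z -> y = z) ->
  ~ atleast (fun y => Y y /\ reach (3 * 8 ^ k) x y) K.+1.
Proof.
move=> Yd Ysep [ys [uys sys ysP]].
case: ys uys sys ysP => // y0 ys uys sys ysP.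
have [y [yys ymin]] : exists y, y \in y0 :: ys /\ forall z, z \in y0 :: ys ->
    (#|` bal (8 ^ k) y| <= #|` bal (8 ^ k) z|)%N.
  have ex : exists n, [exists i : 'I_(size (y0 :: ys)),
      #|` bal (8 ^ k) (nth y0 (y0 :: ys) i)| == n].
    by exists #|` bal (8 ^ k) y0|; apply/existsP; exists ord0.
  have [_ /existsP[i /eqP <-] imin] := ex_minnP ex.
  exists (nth y0 (y0 :: ys) i); split; first exact: mem_nth.
  move=> z zys; apply: imin; apply/existsP.
  have zi : (index z (y0 :: ys) < size (y0 :: ys))%N by rewrite index_mem.
  by exists (Ordinal zi); rewrite /= -/(nth y0 (y0 :: ys) (index z (y0 :: ys))) nth_index.
have [Yy xy] := ysP _ yys.
have /(packing uys) : forall z, z \in y0 :: ys ->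
    (#|` bal (8 ^ k) y| <= #|` bal (8 ^ k) z|)%N /\ {subset bal (8 ^ k) z <= bal (8 ^ k.+1) y}.
  move=> z zys; split; first exact: ymin.
  move=> t /balP zt; apply/balP; have [_ xz] := ysP _ zys.
  (* The distance is at most 3s + 3s + s, below 8s. *)
  apply: (reach_cat (reach_sym Esym xy) (reach_cat xz zt (leqnn _))).
  by rewrite expnS; lia.
rewrite sys => pack; have {pack} : (K.+1 * #|` bal (8 ^ k) y| <= #|` bal (8 ^ k.+1) y|)%N.
  apply: pack => z t u zys tys /balP zu /balP tu.
  apply: Ysep; [exact: (ysP _ zys).1|exact: (ysP _ tys).1|].
  by apply: reach_cat zu (reach_sym Esym tu) _; lia.
by have := Yd _ Yy; rewrite /doubling; have := bal_gt0 (8 ^ k) y; lia.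
Qed.

Definition net k : set V :=
  sval (cid (borel_net (P := P) Esym ball_bound bE (2 * 8 ^ k) (bor_doubling k))).

Lemma netP k : [/\ bor (fun w => net k (w 0%N)), forall x, net k x -> doubling k x,
    forall x y, net k x -> net k y -> reach (2 * 8 ^ k) x y -> x = y &
    forall x, doubling k x -> exists y, net k y /\ reach (2 * 8 ^ k) x y].
Proof. by rewrite /net; case: cid. Qed.

(** With s = 8 ^ k this is 2s + i s / K as soon as d < k. *)
Definition radius k i := (2 * 8 ^ k + i * 8 ^ (k - d.+1))%N.

Definition trace k i x : set V := fun y => net k y /\ reach (radius k i) x y.

(** As traces increase with the radius, both traces have exactly i + 1 points and coincide. *)
Definition typed k i (x : V) : Prop :=
  doubling k x /\ atleast (trace k i x) i.+1 /\ ~ atleast (trace k i.+1 x) i.+2.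

(** Equality of traces is written with quantifiers over balls to keep it Borel. On the diagonal it
    reduces to [typed]. *)
Definition same_trace k i (x y : V) : Prop :=
  (typed k i x /\ typed k i y) /\
  ((forall z, reach (radius k i) x z -> net k z -> reach (radius k i) y z) /\
   (forall z, reach (radius k i) y z -> net k z -> reach (radius k i) x z)).

Lemma bor_typed k i j : bor (fun w => typed k i (w j)).
Proof.
have [bnet _ _ _] := netP k.
have btr i' l : bor (fun w => atleast (trace k i' (w 0%N)) l).
  have [m mP] := ball_bound (radius k i').
  apply: (@bor_atleast V P m l (fun y w => trace k i' (w 0%N) y)).
    apply: sg_and; first exact: (bor1 (P := P) 0%N bnet).
    exact: (bor_reach (P := P) ball_bound bE).
  by move=> w; apply: fibre_bound_sub (mP (w 0%N)) => x [].
apply: (bor1 (P := P)); apply: sg_and; first exact: bor_doubling.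
by apply: sg_and => //; exact: sgN.
Qed.

Lemma bor_same_trace k i : bor (fun w => same_trace k i (w 0%N) (w 1%N)).
Proof.
have [bnet _ _ _] := netP k.
have half a b : bor (fun w => forall z, reach (radius k i) (w a) z -> net k z ->
    reach (radius k i) (w b) z).
  apply: (@bor_all_reach V P E ball_bound bE _ a
    (fun z w => net k z -> reach (radius k i) (w b) z)).
  apply: sg_imp; first exact: (bor1 (P := P) 0%N bnet).
  exact: (bor_reach (P := P) ball_bound bE).
by apply: sg_and; apply: sg_and => //; exact: bor_typed.
Qed.

Lemma same_trace_sym k i x y : same_trace k i x y -> same_trace k i y x.
Proof. by move=> [[tx ty] [xy yx]]. Qed.

Lemma same_trace_trans k i x y z :
  same_trace k i x y -> same_trace k i y z -> same_trace k i x z.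
Proof.
move=> [[tx ty] [xy yx]] [[_ tz] [yz zy]]; split=> //; split=> t rt nt.
  by apply: yz => //; exact: xy.
by apply: yx => //; exact: zy.
Qed.

Lemma radius_le k i : (d < k)%N -> (i <= K)%N -> (radius k i <= 3 * 8 ^ k)%N.
Proof.
move=> dk iK; rewrite /radius.
have : (i * 8 ^ (k - d.+1) <= 8 ^ k)%N.
  rewrite -[X in (_ <= 8 ^ X)%N](subnKC dk) expnD leq_mul2r.
  by rewrite iK orbT.
lia.
Qed.

(** The common trace is nonempty, and any point of it is within 3s of both vertices. *)
Lemma same_trace_reach k i x y : (d < k)%N -> (i < K)%N -> same_trace k i x y ->
  reach (6 * 8 ^ k) x y.
Proof.
move=> dk iK [[[_ [[s [us sk sP]] _]] _] [xy _]].
case: s us sk sP => // z s _ _ sP; have [nz xz] := sP z (mem_head _ _).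
have yz := xy _ xz nz; have := radius_le dk (ltnW iK) => rk.
by apply: (reach_cat xz (reach_sym Esym yz)); lia.
Qed.

(** A point in the trace of one vertex is within the next radius of the other, whose trace does not
    grow during that step. *)
Lemma same_trace_sep k i x y : same_trace k i x x -> same_trace k i y y ->
  reach (8 ^ (k - d.+1)) x y -> same_trace k i x y.
Proof.
move=> [[tx _] _] [[ty _] _] xy; split=> //.
have half u v : typed k i u -> typed k i v -> reach (8 ^ (k - d.+1)) u v ->
    forall z, reach (radius k i) u z -> net k z -> reach (radius k i) v z.
  move=> [_ [au nu]] [_ [av nv]] uv z uz nz.
  have tvu t : trace k i v t -> trace k i.+1 v t.
    by move=> [nt vt]; split=> //; apply: reach_le vt; rewrite /radius; lia.
  apply: (atleast_squeeze tvu av nv _).2; split=> //.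
  by apply: reach_cat (reach_sym Esym uv) uz _; rewrite /radius; lia.
by split; apply: half => //; exact: reach_sym.
Qed.

(** The trace has a point at [i = 0] by maximality of the net, but not K + 1 points at [i = K]; the
    type is a place where having i + 1 points ceases. *)
Lemma typed_exists k x : (d < k)%N -> doubling k x -> exists i, (i < K)%N /\ typed k i x.
Proof.
move=> dk dx; have [_ nd ns nm] := netP k.
have [||i [iK ai ni]] := @switch_point (fun i => atleast (trace k i x) i.+1) K.
- have [y [ny xy]] := nm _ dx; exists [:: y]; split=> // z; rewrite inE => /eqP ->; split=> //.
  by apply: reach_le xy; rewrite /radius; lia.
- move=> aK; apply: (net_multiplicity (x := x) nd ns).
  apply: atleast_sub aK => y [ny xy]; split=> //; apply: reach_le xy; exact: radius_le.
- by exists i.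
Qed.

Lemma same_trace_exists k x : (d < k)%N -> doubling k x ->
  exists i, (i < K)%N /\ same_trace k i x x.
Proof. by move=> dk /(typed_exists dk)[i [iK ti]]; exists i. Qed.

(** * Choice of scales and assembly of the toast *)

Section ToastFromScales.
Variable r : nat.

Let J := (d + 3)%N.

(* The index t encodes both the residue mod J of the scales in use, which keeps
   consecutive scales a factor 8 ^ J apart, and the type i < K. *)
Definition scale t n := ((n + r + 1) * J + t %% J)%N.
Definition type t := ((t %/ J) %% K)%N.

Definition recurrent t (x : V) : Prop :=
  forall N, exists n, (N <= n)%N /\ same_trace (scale t n) (type t) x x.
(** While [recurrent] concerns a single vertex, this concerns its component; the least such index is
    a Borel choice constant on components. *)
Definition saturated t (x : V) : Prop := exists l y, reach l x y /\ recurrent t y.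
Definition first_saturated t (x : V) : Prop :=
  saturated t x /\ forall t', (t' < t)%N -> ~ saturated t' x.

(** The restriction makes families with different indices live in different components. *)
Definition local_cluster t n (x y : V) : Prop :=
  same_trace (scale t n) (type t) x y /\ (first_saturated t x /\ first_saturated t y).

Lemma scale_large t n : (d.+2 + (3 * (n + r)).+1 <= scale t n)%N.
Proof. by rewrite /scale /J; nia. Qed.

Lemma type_lt t : (type t < K)%N.
Proof. by rewrite ltn_mod expn_gt0. Qed.

Let a t n := (6 * 8 ^ scale t n)%N.
Let b t n := (8 ^ (scale t n - d.+1))%N.

(** By the choice of [J], the next bound is 8 ^ (scale t n + 1), eight times the current scale: six
    for the diameter of a class, the rest for the lower terms. *)
Lemma chain_diam_small t n : (chain_diam r (a t) n <= 8 ^ (scale t n - d.+2))%N.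
Proof.
elim: n => [//|n IH] /=.
have sl := scale_large t n.
have -> : (scale t n.+1 - d.+2 = (scale t n).+1)%N.
  by rewrite /scale /J; have := scale_large t n; rewrite /scale /J; nia.
rewrite expnS; rewrite /a in IH *.
have : (64 * 8 ^ (scale t n - d.+2) <= 8 ^ scale t n)%N.
  by rewrite -(@expnD 8 2) leq_exp2l//; lia.
have : (3 * (n + r) < 8 ^ (scale t n - d.+2))%N.
  by apply: (@leq_ltn_trans (scale t n - d.+2)); [lia|exact: ltn_expl].
move: IH; set X := (8 ^ (_ - _))%N; set S := (8 ^ _)%N; lia.
Qed.

Lemma separation_large t n : (2 * n + 3 * chain_diam r (a t) n + 6 * r <= b t n)%N.
Proof.
have sl := scale_large t n; have := chain_diam_small t n.
have -> : (b t n = 8 * 8 ^ (scale t n - d.+2))%N.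
  by rewrite /b -expnS; congr (8 ^ _)%N; lia.
have : (3 * (n + r) < 8 ^ (scale t n - d.+2))%N.
  by apply: (@leq_ltn_trans (scale t n - d.+2)); [lia|exact: ltn_expl].
set X := (8 ^ (_ - _))%N; lia.
Qed.

Lemma recurrent_exists x : exists t, recurrent t x.
Proof.
have [|t [_ tP]] := @infinite_pigeonhole (J * K)
    (fun t n => same_trace (scale t n) (type t) x x); last by exists t.
move=> N; pose M := ((N + r + 1) * J)%N.
have J0 : (0 < J)%N by rewrite /J; lia.
have [k [Mk dk]] := doubling_io x M.
have d_lt : (d < k)%N by apply: leq_trans Mk; rewrite /M /J; nia.
have [i [iK ti]] := same_trace_exists d_lt dk.
(* These values invert the encoding: the scale becomes [k] and the type [i]. *)
exists (i * J + k %% J)%N, (k %/ J - r - 1)%N.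
have km : (N + r + 1 <= k %/ J)%N by rewrite leq_divRL.
have kJ : (k %% J < J)%N by rewrite ltn_mod.
split; [|lia|].
  by have : (i.+1 * J <= K * J)%N; [rewrite leq_mul2r iK orbT|rewrite mulSn; lia].
rewrite /scale /type modnMDl modn_mod divnMDl// (divn_small kJ) addn0 (modn_small iK).
rewrite (_ : (k %/ J - r - 1 + r + 1) = k %/ J)%N; last by lia.
by rewrite -divn_eq.
Qed.

Lemma first_saturated_exists x : exists t, first_saturated t x.
Proof.
have [t0 rt0] := recurrent_exists x.
have ex : exists t, `[< saturated t x >].
  by exists t0; apply/asboolP; exists 0%N, x.
have [t /asboolP st tmin] := ex_minnP ex; exists t; split=> // t' t't /asboolP/tmin.
by rewrite leqNgt t't.
Qed.

Lemma first_saturated_uniq t t' x : first_saturated t x -> first_saturated t' x -> t = t'.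
Proof.
move=> [st mt] [st' mt']; apply/eqP; rewrite eqn_leq; apply/andP; split; rewrite leqNgt.
  by apply/negP => /mt.
by apply/negP => /mt'.
Qed.

Lemma first_saturated_reach t l x y : reach l x y -> first_saturated t x -> first_saturated t y.
Proof.
have sat l' u v t' : reach l' u v -> saturated t' u -> saturated t' v.
  move=> uv [k [w [uw rw]]]; exists (l' + k)%N, w; split=> //.
  exact: reach_cat (reach_sym Esym uv) uw (leqnn _).
move=> xy [sx mx]; split; first exact: sat xy sx.
by move=> t' /mx nx sy; apply/nx/(sat l y x) => //; exact: reach_sym.
Qed.

Lemma local_cluster_sym t n x y : local_cluster t n x y -> local_cluster t n y x.
Proof. by move=> [/same_trace_sym yx [fx fy]]. Qed.

Lemma local_cluster_trans t n x y z :
  local_cluster t n x y -> local_cluster t n y z -> local_cluster t n x z.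
Proof. by move=> [xy [fx _]] [yz [_ fz]]; split=> //; exact: same_trace_trans xy yz. Qed.

Lemma local_cluster_reach t n x y : local_cluster t n x y -> reach (a t n) x y.
Proof.
move=> [xy _]; apply: same_trace_reach xy; last exact: type_lt.
by have := scale_large t n; lia.
Qed.

Lemma local_cluster_sep t n x y : local_cluster t n x x -> local_cluster t n y y ->
  reach (b t n) x y -> local_cluster t n x y.
Proof.
by move=> [xx [fx _]] [yy [fy _]] xy; split=> //; exact: same_trace_sep.
Qed.

Lemma bor_first_saturated t i : bor (fun w => first_saturated t (w i)).
Proof.
have brec t' : bor (fun w => recurrent t' (w 0%N)).
  apply: sg_allN => N; apply: sg_exN => n; apply: sg_and; first exact: sg_cst.
  exact: (bor_reindex (fun=> 0%N) (bor_same_trace _ _)).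
have bsat t' : bor (fun w => saturated t' (w 0%N)).
  apply: sg_exN => l.
  exact: (@bor_ex_reach V P E ball_bound bE l 0%N (fun y w => recurrent t' y)).
apply: (bor1 (P := P)); apply: sg_and => //; apply: sg_allN => t'.
by apply: sg_imp; [exact: sg_cst|exact: sgN].
Qed.

Lemma bor_local_cluster t n : bor (fun w => local_cluster t n (w 0%N) (w 1%N)).
Proof.
by apply: sg_and; [exact: bor_same_trace|apply: sg_and; exact: bor_first_saturated].
Qed.

Definition toast_pieces : set {fset V} := fun L =>
  exists t n, pieces E r (local_cluster t) n L.

Lemma borel_toast_pieces : borel_finsets (sgen (p_open P)) toast_pieces.
Proof.
move=> k; rewrite /tuple_borel -sgenE; apply: sg_exN => t; apply: sg_exN => n.
have bp : borel_finsets (sgen (p_open P)) (pieces E r (local_cluster t) n).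
  by apply: borel_pieces => // m; exact: bor_local_cluster.
by have := bp k; rewrite /tuple_borel -sgenE.
Qed.

Lemma toast_pieces_cover u v : (0 < r)%N -> E u v ->
  exists2 L : {fset V}, toast_pieces L & u \in L /\ v \in L.
Proof.
move=> r_gt0 uv; have [t ft] := first_saturated_exists u.
(* A level of at least l + 1 puts both [u] and its neighbour [v] in the n-neighbourhood of [y]. *)
have [[l [y [uy ry]]] _] := ft; have [n [ln Qy]] := ry l.+1.
have Qn : local_cluster t n y y.
  by split=> //; split; exact: first_saturated_reach uy ft.
have yu := reach_sym Esym uy.
have uv1 : reach 1 u v by exists v; split; [right|].
have [L [pL uL vL]] : exists L : {fset V}, [/\ pieces E r (local_cluster t) n L, u \in L & v \in L].
  apply: (@pieces_cover V E r Esym _ (local_cluster t) (a t) (b t)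
    (@local_cluster_sym t) (@local_cluster_trans t) (@local_cluster_reach t)
    (@local_cluster_sep t) (separation_large t)).
  - by move=> k x; have [m /(_ x)[s [_ sP]]] := ball_bound k; exists s.
  - by exists y; split=> //; apply: reach_le yu; exact: ltnW.
  - by exists y; split=> //; apply: (reach_cat yu uv1); rewrite addn1.
  - exact: reach_le uv1.
by exists L => //; exists t, n.
Qed.

Lemma pieces_first_saturated t n L x :
  pieces E r (local_cluster t) n L -> x \in L -> first_saturated t x.
Proof.
move=> [_ Lc _ _] /Lc cx.
have [k [w [[_ [fw _]] wx]]] := covered_clusters Esym (@local_cluster_sym t)
  (@local_cluster_trans t) (@local_cluster_reach t) (@local_cluster_sep t)
  (separation_large t) cx.
exact: first_saturated_reach wx fw.
Qed.

(** Pieces with different indices lie in different components; those with the same index are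
    compared by [pieces_laminar]. *)
Lemma toast_pieces_laminar L M : toast_pieces L -> toast_pieces M -> L <> M ->
  [\/ forall x y, x \in L -> reach r x y -> y \notin M,
      forall x y, x \in L -> reach r x y -> y \in M |
      forall x y, x \in M -> reach r x y -> y \in L].
Proof.
move=> [t [n pL]] [t' [n' pM]] LM.
have [tt'|tt'] := eqVneq t t'; last first.
  constructor 1 => x y xL xy; apply/negP => yM; move/eqP: tt'; apply.
  apply: (first_saturated_uniq (x := y)); last exact: pieces_first_saturated pM yM.
  exact: first_saturated_reach xy (pieces_first_saturated pL xL).
subst t'; have [nn|/ltnW nn] := leqP n n'.
  by case: (pieces_laminar Esym pL pM nn LM) => ?; [constructor 1|constructor 2].
case: (pieces_laminar Esym pM pL nn (nesym LM)) => H; last by constructor 3.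
constructor 1 => x y xL xy; apply/negP => yM.
by have := H _ _ yM (reach_sym Esym xy); rewrite xL.
Qed.

End ToastFromScales.

End Scales.

(** * From the growth rate to the theorem *)

Lemma polynomial_growth_card (R : realType) (V : choiceType) (E : rel V) :
  polynomial_growth R E -> exists d n0, forall n u, (n0 <= n)%N ->
    finite_set (reach E n u : set V) /\
    (#|` fset_set (reach E n u : set V)| <= n.+1 ^ d)%N.
Proof.
rewrite /polynomial_growth /growth_rate /limn_esup /limf_esup.
move=> /ereal_inf_lt[_ [W [n1 _ n1W] <-]] supW.
have [C CP] : exists C : nat, forall n, (n1 <= n)%N ->
    (lne (growth R E n) / (ln (n.+1%:R : R))%:E <= C%:R%:E)%E.
  have [C CP] : exists C : nat, (ereal_sup [set lne (growth R E n) / (ln (n.+1%:R : R))%:E |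
      n in W] <= C%:R%:E)%E.
    case: (ereal_sup _) supW => [x _|//|_]; last by exists 0%N; rewrite leNye.
    exists (Num.bound `|x|%R); rewrite lee_fin ltW//.
    exact: le_lt_trans (ler_norm x) (archi_boundP (normr_ge0 x)).
  exists C => n nn; apply: le_trans CP; apply: ereal_sup_ubound; exists n => //; exact: n1W.
(* Adding 1 forces n >= 1, so that the logarithm in the denominator is positive. *)
exists C, (n1 + 1)%N => n u nn; have {}CP : (lne (growth R E n) / (ln (n.+1%:R : R))%:E <= C%:R%:E)%E by apply: CP; lia.
have L0 : (0 < ln (n.+1%:R : R))%R by rewrite ln_gt0// ltr1n; lia.
have : (counting (reach E n u : set V) <= growth R E n)%E.
  by apply: ereal_sup_ubound; exists u => //; rewrite gballE.
have Vn0 : (ln (n.+1%:R : R))%:E != 0%E by rewrite eqe gt_eqF.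
move: CP; case: (growth R E n) => [x||].
- move=> CP; rewrite /counting; case: asboolP => // fin; rewrite lee_fin => cx; split=> //.
  have [x0|x0] := ltP 0%R x; last first.
    have : (#|` fset_set (reach E n u : set V)|%:R <= 0 :> R)%R := le_trans cx x0.
    by rewrite lern0 => /eqP ->.
  move: CP; rewrite lne_EFin// inver gt_eqF// -EFinM lee_fin ler_pdivrMr//.
  rewrite mulr_natl -lnXn ?ltr0n// ler_ln ?posrE ?exprn_gt0 ?ltr0n// => xn.
  by rewrite -(ler_nat R) natrX (le_trans cx).
(* Infinite growth would make the quotient infinite, against its bound [C]. *)
- rewrite /= inver gt_eqF// mulyr gtr0_sg ?invr_gt0// mul1e.
  by [].
- by rewrite /counting; case: asboolP.
Qed.

(** The construction is run with r + 1, which is positive even for r = 0, so that an edge counts as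
    one step of a chain; the larger radius only strengthens laminarity. *)
Lemma toastE (R : realType) (V : choiceType) (B : set_system V) (E : rel V) (r : nat)
    (T : set {fset V}) : symmetric E -> borel_finsets B T ->
  (forall u v, E u v -> exists2 L : {fset V}, T L & u \in L /\ v \in L) ->
  (forall L M : {fset V}, T L -> T M -> L <> M ->
    [\/ forall x y, x \in L -> reach E r.+1 x y -> y \notin M,
        forall x y, x \in L -> reach E r.+1 x y -> y \in M |
        forall x y, x \in M -> reach E r.+1 x y -> y \in L]) ->
  toast R B E r T.
Proof.
move=> Esym bT cT lT; split=> // L M TL TM /(lT _ _ TL TM) lam.
have up x y : gball R E x r y -> reach E r.+1 x y.
  by rewrite gballE; apply: reach_le.
case: lam => H; [constructor 1|constructor 2|constructor 3].
- rewrite -subset0 => y [[x /= xL /up xy] yM].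
  by have := H _ _ xL xy; rewrite yM.
- by move=> y [x /= xL /up xy]; exact: H xL xy.
- by move=> y [x /= xM /up xy]; exact: H xM xy.
Qed.

Theorem corollary1p18 (R : realType) (V : choiceType) (B : set_system V)
    (E : rel V) (r : nat) :
  borel_graph R B E -> polynomial_growth R E ->
  exists T : set {fset V}, toast R B E r T.
Proof.
move=> [sB [Esym _] pE] /polynomial_growth_card[d [n0 grow]].
have [[v0 _]|nV] := pselect (exists v : V, True); last first.
  exists (fun=> False); apply: toastE => //; last by move=> u; case: nV; exists u.
  by move=> k; rewrite /tuple_borel -sgenE; exact: sg_cst.
have [P BP] := standard_borel_polish v0 sB; subst B.
have bE i j : sgen (env_open P) (fun w => E (w i) (w j)) := @bor_binary V P E i j pE.
have ball_bound n : exists m, forall u, fibre_bound m (reach E n u).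
  (* The growth bound holds from [n0] on; a smaller ball is counted inside the ball of radius
     [n0]. *)
  exists ((maxn n n0).+1 ^ d)%N => u; have [fin card] := grow _ u (leq_maxr n n0).
  exists (fset_set (reach E (maxn n n0) u)); split=> // x nx.
  by rewrite in_fset_set// inE /=; apply: reach_le nx; exact: leq_maxl.
have growth n u : (n0 <= n)%N -> (#|` bal E n u| <= n.+1 ^ d)%N.
  by move=> /(grow n u)[].
exists (toast_pieces Esym ball_bound bE d r.+1); apply: toastE => //.
- exact: borel_toast_pieces.
- by move=> u v; apply: (toast_pieces_cover _ _ _ growth).
- exact: toast_pieces_laminar.
Qed.
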